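(* Let a cut and project scheme be given, consisting of $\mathbb{R}^m$, a locally compact Abelian group $H$ and a lattice $\tilde{L}\subset\mathbb{R}^m\times H$, with $L=\pi(\tilde{L})$ and star map $(\cdot)^*:L\to H$. Let $\theta$ be a Haar measure on $H$. Let $\Lambda=\Lambda(W)=\{x\in L\mid x^*\in W\}$ be a model set, where $W\subset H$ is compact, equal to the closure of its nonempty interior, and Riemann measurable. Let $f:H\to\mathbb{R}$ be continuous with $\mathrm{supp}(f)\subset W$, and let $p:L\to\mathbb{R}$ be defined by $p(x)=f(x^* )$. Then $$\lim_{r\to\infty}\frac{1}{\mathrm{vol}\,B_r(0)}\sum_{x\in\Lambda\cap B_r(a)}p(x)=\frac{1}{|\tilde{L}|}\int_H f(y)\,\mathrm{d}\theta(y),$$ uniformly in $a\in\mathbb{R}^m$.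
   Context: Cut and project scheme: $\pi$ and $\pi_H$ denote the canonical projections of $\mathbb{R}^m\times H$ onto $\mathbb{R}^m$ and $H$. A lattice $\tilde{L}\subset\mathbb{R}^m\times H$ is a discrete subgroup with $(\mathbb{R}^m\times H)/\tilde{L}$ compact. It is required that $\pi|_{\tilde{L}}$ is one-to-one and that $\pi_H(\tilde{L})$ is dense in $H$. One sets $L=\pi(\tilde{L})$ and defines the star map by $x^*=\pi_H\circ(\pi|_{\tilde{L}})^{-1}(x)$ for $x\in L$. A set $W\subset H$ is Riemann measurable if it is measurable and $\theta(\partial W)=0$. $B_r(a)$ is the ball of radius $r$ around $a$ in $\mathbb{R}^m$ and $\mathrm{vol}$ is Lebesgue measure. $|\tilde{L}|:=\tilde\theta(T)$, where $\tilde\theta$ is the product of Lebesgue measure on $\mathbb{R}^m$ and $\theta$, and $T$ is any measurable fundamental domain of $\mathbb{R}^m\times H$ for the translation action of $\tilde{L}$ (the value does not depend on $T$).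
   Formalization: The fundamental domain T defining |L̃| is also required to project into a countable union of compact subsets of H (automatic if H is σ-compact); for H = ℝ/ℤ discrete, L̃ = {(x, x mod ℤ)}, the measure of T otherwise depends on T. *)

(* Defs.v *)
From HB Require Import structures.
From mathcomp Require Import all_boot all_order all_algebra.
From mathcomp Require Import all_classical all_reals all_analysis.

Set Implicit Arguments.
Unset Strict Implicit.
Unset Printing Implicit Defensive.

Import Order.TTheory GRing.Theory Num.Theory.
Import numFieldNormedType.Exports.

Local Open Scope classical_set_scope.
Local Open Scope ring_scope.

(* The library equips [g_sigma_algebraType open] with a measurable structure only
   when the base type is pointed; here the distinguished point is 0. *)
Definition borel (G : topologicalZmodType) : Type := G.

Section borel.
Context {G : topologicalZmodType}.

HB.instance Definition _ := Choice.on (borel G).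
HB.instance Definition _ := isPointed.Build (borel G) (0 : G).
HB.instance Definition _ := @isMeasurable.Build (sigma_display (@open G))
  (borel G) <<s @open G >> (@sigma_algebra0 _ setT _)
  (@sigma_algebraC (borel G) _) (@sigma_algebra_bigcup _ setT _).

End borel.

Definition boundary (X : topologicalType) (W : set X) : set X :=
  closure W `\` W°.

Section euclidean_space.
Context {R : realType}.

(* The norm that the library puts on ['rV[R]_m] is the sup norm, hence the
   explicit Euclidean ball. *)
Definition euclidean_ball m (a : 'rV[R]_m) (r : R) : set 'rV[R]_m :=
  [set x | Num.sqrt (\sum_(i < m) (x ord0 i - a ord0 i) ^+ 2) < r].

(* The m-fold product of the one-dimensional Lebesgue measure, computed on Borel
   sets by integrating the measures of the sections along the first coordinate.
   For m = 0 this is the unit mass at the only point. *)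
Fixpoint lebesgue_rV (m : nat) : set (borel 'rV[R]_m) -> \bar R :=
  match m return set (borel 'rV[R]_m) -> \bar R with
  | 0 => fun A => (\1_A (0 : 'rV[R]_0))%:E
  | k.+1 => fun A =>
      (\int[lebesgue_measure]_t
         lebesgue_rV [set v : 'rV[R]_k | A (row_mx (const_mx t : 'rV[R]_1) v)])%E
  end.

End euclidean_space.

Section haar.
Context {R : realType} {H : topologicalZmodType}.

Definition haar_measure (theta : {measure set (borel H) -> \bar R}) : Prop :=
  [/\ (theta setT != 0)%E,
      forall K : set H, compact K -> (theta K < +oo)%E,
      forall (x : H) (A : set (borel H)), measurable A ->
        theta [set x + y | y in (A : set H)] = theta A,
      forall A : set (borel H), measurable A ->
        theta A = ereal_inf [set theta U | U in [set U : set H |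
                    open U /\ A `<=` U]]
    & forall U : set H, open U ->
        theta U = ereal_sup [set theta K | K in [set K : set H |
                    compact K /\ K `<=` U]] ].

Definition riemann_measurable (theta : {measure set (borel H) -> \bar R})
    (W : set H) : Prop :=
  measurable (W : set (borel H)) /\ theta (boundary W) = 0%E.

End haar.

Section cut_and_project.
Context {R : realType} {m : nat} {H : topologicalZmodType}.
Implicit Types (Lt : zmodClosed ('rV[R]_m * H)%type).

Definition lattice Lt : Prop :=
  [set` Lt] `<=` isolated [set` Lt] /\
  compact [set: quotient_topology (Quotient.quot Lt)].

Definition cut_and_project_scheme Lt : Prop :=
  [/\ lattice Lt, {in Lt &, injective fst} & dense (snd @` [set` Lt])].

Definition projected_lattice Lt : set 'rV[R]_m := fst @` [set` Lt].

(* Outside of [projected_lattice Lt] the value is 0, and is never used. *)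
Definition star Lt (x : 'rV[R]_m) : H :=
  ('pinv_(fun=> 0) [set` Lt] fst x).2.

Definition model_set Lt (W : set H) : set 'rV[R]_m :=
  [set x | projected_lattice Lt x /\ W (star Lt x)].

Definition product_measure (theta : set (borel H) -> \bar R) :
    set (borel 'rV[R]_m * borel H) -> \bar R :=
  (@lebesgue_rV R m \x^ theta)%E.

(* Without the second clause, which is automatic when H is sigma-compact, the
   measure of a fundamental domain is not determined by the lattice: for
   H = R/Z with the discrete topology and the lattice {(x, x mod Z)} in R * H,
   both [0, 1[ * {0} and {0} * H are measurable sets of representatives, and
   their measures are 1 and 0. *)
Definition fundamental_domain Lt (T : set (borel 'rV[R]_m * borel H)) : Prop :=
  [/\ measurable T,
      exists2 K : (set H)^nat, (forall n, compact (K n)) &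
        T `<=` snd @^-1` \bigcup_n K n
    & forall z : 'rV[R]_m * H, exists! t, T t /\ z - t \in Lt].

End cut_and_project.

(* Main.v *)
(* Write G = R^m * H, let nu be the product measure, and for a weight
   F = 1_{B_r(a)} (x) g on G let (N F)(z) be the sum of F (z + l) over the
   lattice, so that (N F)(0) is the sum in the theorem for f = g.  Unfolding the
   integral of F over the fundamental domain T gives
     \int_T N F dnu = vol B_r * \int_H g dtheta,
   and N F is periodic.  Since the projection of the lattice to H is dense, any
   z in a compact set can be moved by a lattice vector so that its H-component
   is almost 0 while its R^m-component stays bounded; uniform continuity of g
   and the negligible volume of the shell of B_r(a) then give
   (N F)(z) = (N F)(0) + o(vol B_r), uniformly in a.  Uniform discreteness gives
   N F = O(vol B_r) everywhere, which takes care of the part of T outside a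
   compact set; hence nu(T) * (N F)(0) is asymptotically vol B_r * \int g. *)
From HB Require Import structures.
Require Import Defs.
From mathcomp Require Import all_boot all_order all_algebra finmap.
From mathcomp Require Import all_classical all_reals all_analysis.
From mathcomp Require Import measurable_realfun ring lra.

Set Implicit Arguments.
Unset Strict Implicit.
Unset Printing Implicit Defensive.

Import Order.TTheory GRing.Theory Num.Theory.
Import numFieldNormedType.Exports.

Local Open Scope classical_set_scope.
Local Open Scope ring_scope.

(** * Lebesgue measure on row vectors *)

(** [H] is not assumed sigma-compact, and this shapes the proof: [theta] need not be sigma-finite
    and the lattice may be uncountable, so neither Tonelli's theorem nor the exchange of sum and
    integral is available at once. The product measure relies on the sigma-finiteness of Lebesgue
    measure alone, and the one product integral that is needed, of an indicator on [R^m] times a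
    function on [H], is read off from an image measure under [snd]. Countability comes from the
    second clause of [fundamental_domain]: seen from the points of [T], a function supported over a
    compact subset of [H] meets only countably many lattice vectors. Unfolding is an identity in
    [[0, +oo]], so nonnegative weights come first and a signed [f] is split at the end. Dividing by
    [nu T] requires [0 < nu T < +oo]; both bounds follow from unfolding the indicators of
    rectangles. *)

Lemma open_borel (G : topologicalZmodType) (U : set G) :
  open U -> measurable (U : set (borel G)).
Proof. by move=> oU; exact: sub_sigma_algebra. Qed.

Lemma closed_borel (G : topologicalZmodType) (U : set G) :
  closed U -> measurable (U : set (borel G)).
Proof.
move=> cU; rewrite -[U]setCK; apply: measurableC; apply: open_borel.
exact: closed_openC.
Qed.

Lemma measurable_fun_borel d (Y : measurableType d) (G : topologicalZmodType)
    (h : Y -> borel G) :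
  (forall U : set G, open U -> measurable (h @^-1` U)) ->
  measurable_fun setT h.
Proof.
move=> hU; apply: (@measurability _ _ Y (borel G) setT h (@open G)) => //.
by move=> _ [U oU <-]; rewrite setTI; exact: hU.
Qed.

Lemma continuous_borel (G1 G2 : topologicalZmodType) (h : G1 -> G2) :
  continuous h -> measurable_fun setT (h : borel G1 -> borel G2).
Proof.
move=> /continuousP ch; apply: measurable_fun_borel => U oU.
by apply: open_borel; exact: ch.
Qed.

Lemma continuous_borel_real (R : realType) (G : topologicalZmodType) (h : G -> R) :
  continuous h -> measurable_fun setT (h : borel G -> measurableTypeR R).
Proof.
move=> /continuousP ch.
apply: (measurability _ (RGenOpens.measurableE R)).
move=> _ [_ [a [b ->] <-]]; rewrite setTI; apply: open_borel; apply: ch.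
exact: interval_open.
Qed.

Section sigma_finite_copy.
Context d (T : measurableType d) (R : realType).
(** A renaming of [mu] to which a canonical sigma-finite structure can be attached from the proof
    [h]. The induction that builds Lebesgue measure needs this, since there sigma-finiteness is only
    a derived fact about an existential witness. *)
Definition sigma_finite_copy (mu : {measure set T -> \bar R})
  (h : sigma_finite setT mu) : set T -> \bar R := mu.
Variables (mu : {measure set T -> \bar R}) (h : sigma_finite setT mu).
HB.instance Definition _ := Measure.on (sigma_finite_copy h).
HB.instance Definition _ :=
  Measure_isSigmaFinite.Build _ _ _ (sigma_finite_copy h) h.
End sigma_finite_copy.

Section row_mx_measurable.
Context {R : realType}.

Definition row_cons k (tv : measurableTypeR R * borel 'rV[R]_k)
  : borel 'rV[R]_k.+1 := row_mx (const_mx tv.1 : 'rV[R]_1) tv.2.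

Lemma row_cons_ball k (t s : R) (v w : 'rV[R]_k) e :
  ball (row_mx (const_mx t : 'rV[R]_1) v : 'rV_k.+1) e
       (row_mx (const_mx s : 'rV[R]_1) w) <-> ball t e s /\ ball v e w.
Proof.
split=> [[e0 H]|[H1 [e0 H2]]].
- split; first by have := H ord0 (@lshift 1 k ord0); rewrite !(@row_mxEl _ _ 1) !mxE.
  split=> // i j; rewrite ord1.
  by have := H ord0 (@rshift 1 k j); rewrite !(@row_mxEr _ _ 1).
- split=> // i j; rewrite ord1.
  rewrite -(@splitK 1 k j); case: fintype.splitP => /= j' _.
    by rewrite !(@row_mxEl _ _ 1) !mxE.
  by rewrite !(@row_mxEr _ _ 1).
Qed.

Lemma row_head k (x : 'rV[R]_k.+1) :
  x = row_mx (const_mx (x ord0 ord0) : 'rV[R]_1) (@rsubmx _ 1 1 k x).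
Proof.
rewrite -[LHS](@hsubmxK _ 1 1 k x); suff -> : @lsubmx _ 1 1 k x = const_mx (x ord0 ord0) by [].
by apply/rowP => i; rewrite !ord1 !mxE; congr (x _ _); apply: val_inj.
Qed.

Lemma measurable_ball_rV k (x : 'rV[R]_k) e : measurable (ball x e : set (borel _)).
Proof. by apply: open_borel; exact: ball_open. Qed.

Lemma rat_ball k (x : 'rV[R]_k) (e : R) : 0 < e ->
  exists c : 'rV[rat]_k, ball (map_mx ratr c : 'rV[R]_k) e x.
Proof.
move=> e0.
have /choice[c cP] (j : 'I_k) : exists q : rat, `|ratr q - x ord0 j| < e.
  have xe : x ord0 j < x ord0 j + e by rewrite ltrDl.
  have [q] := rat_in_itvoo xe; rewrite in_itv/= => /andP[q1 q2]; exists q.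
  by rewrite gtr0_norm ?subr_gt0// ltrBlDl.
exists (\row_j c j); split=> // i j; rewrite ord1 !mxE /ball/=.
exact: cP.
Qed.

(** Second countability of row vectors is the point: an open set is a countable union of balls with
    rational centre and radius, and by [row_cons_ball] (the metric is the sup metric) the preimage
    of a ball is a measurable rectangle. *)
Lemma measurable_row_cons k : measurable_fun setT (@row_cons k).
Proof.
apply: measurable_fun_borel => U oU.
pose D := [set cq : 'rV[rat]_k.+1 * rat |
  ball (map_mx ratr cq.1 : 'rV[R]_k.+1) (ratr cq.2) `<=` U].
have -> : @row_cons k @^-1` U = \bigcup_(cq in D)
    (@row_cons k @^-1` ball (map_mx ratr cq.1 : 'rV[R]_k.+1) (ratr cq.2)).
  apply/seteqP; split=> [tv Utv|tv [cq Dcq]]; last exact: Dcq.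
  have /nbhs_ballP[e /= e0 eU] := open_nbhs_nbhs (conj oU Utv).
  have e20 : 0 < e / 2 by rewrite divr_gt0.
  have [q] := rat_in_itvoo e20; rewrite in_itv/= => /andP[q0 qe].
  have [c cP] := rat_ball (row_cons tv) q0.
  exists (c, q) => //= w cw; apply: eU.
  apply: (@le_ball _ _ _ (ratr q + ratr q)).
    by rewrite (splitr e) lerD// ltW.
  by apply: ball_triangle cw; apply: ball_sym.
rewrite bigcup_mkcond; apply: countable_bigcupT_measurable => [|[c q]].
  exact: countableP.
case: ifP => // _ /=.
set x := map_mx _ _; rewrite [x]row_head.
rewrite [X in measurable X](_ : _ =
    (ball (x ord0 ord0) (ratr q) : set (measurableTypeR R)) `*`
    (ball (@rsubmx _ 1 1 k x) (ratr q) : set (borel 'rV[R]_k))); last first.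
  by apply/seteqP; split=> -[t v] /=; rewrite /row_cons/= => /row_cons_ball.
apply: measurableX; first by rewrite ball_itv; exact: measurable_itv.
exact: (@measurable_ball_rV k).
Qed.

End row_mx_measurable.

Notation pushforward_measure :=
  measure_function_pushforward__canonical__measure_function_Measure.

Section lebesgue_rV_measure.
Context {R : realType}.
Local Open Scope ereal_scope.

Lemma ball0_rV_measure_sigma_finite m (mu : {measure set (borel 'rV[R]_m) -> \bar R}) :
  (forall r : R, (0 < r)%R -> mu (ball (0 : 'rV[R]_m)%R r) = ((2 * r) ^+ m)%:E) ->
  sigma_finite setT mu.
Proof.
move=> muB; exists (fun n => ball (0 : 'rV[R]_m)%R n.+1%:R).
  apply/esym; rewrite -subTset => x _.
  have [n xn] : exists n, (`|x : 'rV[R]_m| < n.+1%:R)%R.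
    by exists (Num.truncn `|x : 'rV[R]_m|); exact: real_truncnS_gt.
  by exists n => //; rewrite -ball_normE /ball_/= sub0r normrN.
by move=> n; split; [exact: measurable_ball_rV|rewrite muB// ltry].
Qed.

(** The volume of sup-norm balls is carried through the induction because it yields
    sigma-finiteness, without which the next product measure cannot be formed. The witness is the
    image under [row_cons] of that product. *)
Lemma lebesgue_rV_is_measure m :
  exists mu : {measure set (borel 'rV[R]_m) -> \bar R},
  (forall A, lebesgue_rV A = mu A) /\
  forall r : R, (0 < r)%R -> mu (ball (0 : 'rV[R]_m)%R r) = ((2 * r) ^+ m)%:E.
Proof.
elim: m => [|m [mu [muE muB]]].
  exists (@dirac _ _ (0 : borel 'rV[R]_0)%R R); split=> // r r0.
  by rewrite /= diracE expr0 mem_set//; exact: ballxx.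
pose mu' := sigma_finite_copy (ball0_rV_measure_sigma_finite muB).
exists (pushforward_measure (@lebesgue_measure R \x mu')
  (@measurable_row_cons R m)); split=> [A|r r0].
  rewrite /= /pushforward/= /product_measure1/=; apply: eq_integral => t _.
  rewrite muE /=; congr (mu _); apply/seteqP.
  by split=> v; rewrite /xsection/= inE.
rewrite -[LHS]/((@lebesgue_measure R \x mu') (@row_cons R m @^-1` ball (0 : 'rV[R]_m.+1)%R r)).
rewrite [X in (_ \x _) X](_ : _ = (ball (0 : R)%R r : set (measurableTypeR R)) `*`
    (ball (0 : 'rV[R]_m)%R r : set (borel 'rV[R]_m))); last first.
  have h0 : (0 : 'rV[R]_m.+1)%R = (row_mx (const_mx 0 : 'rV[R]_1) 0)%R.
    exact: esym (@row_mx0 R 1 1 m).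
  by apply/seteqP; split=> -[t v]; rewrite /= h0 => /row_cons_ball.
rewrite product_measure1E; last exact: (@measurable_ball_rV R m).
  rewrite exprS EFinM -muB//; congr (_ * _).
  by rewrite mulr_natl -(lebesgue_measure_ball 0%R (ltW r0)).
by rewrite ball_itv; exact: measurable_itv.
Qed.


Let lebesgue_rV0 m : lebesgue_rV (set0 : set (borel 'rV[R]_m)) = 0.
Proof. by have [mu [-> _]] := lebesgue_rV_is_measure m; exact: measure0. Qed.

Let lebesgue_rV_ge0 m (A : set (borel 'rV[R]_m)) : 0 <= lebesgue_rV A.
Proof. by have [mu [-> _]] := lebesgue_rV_is_measure m; exact: measure_ge0. Qed.

Let lebesgue_rV_sigma_additive m : semi_sigma_additive (@lebesgue_rV R m).
Proof.
have [mu [muE _]] := lebesgue_rV_is_measure m.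
have -> : @lebesgue_rV R m = mu by apply/funext => A; exact: muE.
exact: measure_semi_sigma_additive.
Qed.

HB.instance Definition _ m := isMeasure.Build _ _ _ (@lebesgue_rV R m)
  (@lebesgue_rV0 m) (@lebesgue_rV_ge0 m) (@lebesgue_rV_sigma_additive m).

Lemma lebesgue_rV_ball0 m (r : R) : (0 < r)%R ->
  lebesgue_rV (ball (0 : 'rV[R]_m)%R r : set (borel _)) = ((2 * r) ^+ m)%:E.
Proof. by have [mu [-> ]] := lebesgue_rV_is_measure m; exact. Qed.

HB.instance Definition _ m := Measure_isSigmaFinite.Build _ _ _ (@lebesgue_rV R m)
  (ball0_rV_measure_sigma_finite (@lebesgue_rV_ball0 m)).

Let measurable_affine (s c : R) : measurable_fun setT
  ((fun t : R => s * t + c)%R : measurableTypeR R -> measurableTypeR R).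
Proof.
apply: continuous_measurable_fun => t; apply: cvgD; last exact: cvg_cst.
by apply: cvgM; [exact: cvg_cst|exact: cvg_id].
Qed.

(** By uniqueness of Lebesgue measure: [s] times the image measure under the affine map gives
    half-open intervals their length. *)
Lemma lebesgue_measure_affine (s c : R) (A : set (measurableTypeR R)) :
  (0 < s)%R -> measurable A ->
  lebesgue_measure ((fun t : R => s * t + c)%R @^-1` A)
    = (s^-1)%:E * lebesgue_measure A.
Proof.
move=> s0 mA.
pose mu : {measure set (measurableTypeR R) -> \bar R} :=
  mscale (NngNum (ltW s0)) (pushforward_measure (@lebesgue_measure R) (measurable_affine s c)).
suff -> : lebesgue_measure A = mu A.
  by rewrite /mu/= /mscale/= /pushforward muleA -EFinM mulVf ?gt_eqF// mul1e.
apply: lebesgue_measure_unique => //= _ [[a b]] _ <-.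
have -> : mu `]a, b]%classic =
    s%:E * lebesgue_measure `]((a - c) / s)%R, ((b - c) / s)%R]%classic.
  congr (_ * lebesgue_measure _).
  apply/seteqP; split=> t /=; rewrite !in_itv/= ltr_pdivrMr// ler_pdivlMr//;
  by rewrite ltrBlDr lerBrDr (mulrC s).
rewrite !lebesgue_measure_itv/= !lte_fin ltr_pM2r ?invr_gt0// ltrD2r.
case: ifPn => _; last by rewrite mule0.
rewrite -!EFinB -EFinM; congr EFin.
by rewrite -mulrBl mulrC divfK ?gt_eqF//; ring.
Qed.

(** The map acts coordinatewise, so the section of the preimage at [t] is the preimage of the
    section of [A] at [s * t + c0]. The induction hypothesis gives the factor [s ^- m], the outer
    integral one more. The case [s = 1] is translation invariance, the case [c = 0] the scaling of
    balls. *)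
Lemma lebesgue_rV_affine m (s : R) (c : 'rV[R]_m) (A : set (borel 'rV[R]_m)) :
  (0 < s)%R -> measurable A ->
  lebesgue_rV ((fun x : 'rV[R]_m => s *: x + c)%R @^-1` A)
    = ((s ^+ m)^-1)%:E * lebesgue_rV A.
Proof.
move=> s0; elim: m c A => [|m IH] c A mA.
  rewrite expr0 invr1 mul1e /= !indicE; congr (_%:R%:E).
  apply: congr1; apply/idP/idP; rewrite !inE /=;
  by rewrite (_ : _ + _ = 0)%R//; apply/rowP => -[].
pose c' : 'rV[R]_m := @rsubmx _ 1 1 m c; pose c0 := c ord0 ord0.
pose phi (t : R) := lebesgue_rV (xsection (@row_cons R m @^-1` A) t).
have mhA : measurable (@row_cons R m @^-1` A).
  by rewrite -[X in measurable X]setTI; exact: (@measurable_row_cons R m).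
have mphi : measurable_fun setT (phi : measurableTypeR R -> \bar R).
  by apply: measurable_fun_xsection => //; rewrite inE.
have lamE (B : set (borel 'rV[R]_m.+1)) : lebesgue_rV B =
    \int[lebesgue_measure]_t lebesgue_rV (xsection (@row_cons R m @^-1` B) t).
  apply: eq_integral => t _; congr lebesgue_rV; apply/seteqP.
  by split=> v; rewrite /xsection/= inE.
rewrite lamE.
transitivity (\int[lebesgue_measure]_t (((s ^+ m)^-1)%:E * phi (s * t + c0)%R)).
  apply: eq_integral => t _; rewrite /phi -(IH c'); last exact: measurable_xsection.
  congr lebesgue_rV; apply/seteqP.
  suff h v : (s *: (row_mx (const_mx t : 'rV[R]_1) v : 'rV[R]_m.+1) + c =
      row_mx (const_mx (s * t + c0) : 'rV[R]_1) (s *: v + c') :> 'rV[R]_m.+1)%R.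
    by split=> v; rewrite /xsection/= !inE /row_cons/= h.
  rewrite [c in LHS]row_head.
  rewrite -[s *: _]/(s *: (row_mx (const_mx t : 'rV[R]_1) v : 'rV[R]_(1 + m)))%R.
  rewrite (@scale_row_mx _ 1 1 m).
  apply: etrans (@add_row_mx _ 1 1 m _ _ _ _) _.
  by rewrite (_ : _ + _ = const_mx (s * t + c0))%R//; apply/rowP => i; rewrite !mxE.
rewrite ge0_integralZl//; last 2 first.
- by apply: measurableT_comp mphi _; exact: measurable_affine.
- by rewrite lee_fin invr_ge0 exprn_ge0// ltW.
rewrite exprS invfM EFinM -[in RHS]muleA muleCA; congr (_ * _).
transitivity (\int[pushforward_measure (@lebesgue_measure R)
    (measurable_affine s c0)]_t phi t).
  by rewrite [RHS](ge0_integral_pushforward (measurable_affine s c0)).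
have si0 : (0 <= s^-1)%R by rewrite invr_ge0 ltW.
rewrite (eq_measure_integral (mscale (NngNum si0) lebesgue_measure)).
  by rewrite ge0_integral_mscale -?lamE.
by move=> B mB _; rewrite /= /mscale/= -(lebesgue_measure_affine c0).
Qed.

Lemma lebesgue_rV_translate m (c : 'rV[R]_m) (A : set (borel 'rV[R]_m)) :
  measurable A ->
  lebesgue_rV ((fun x : 'rV[R]_m => x + c)%R @^-1` A) = lebesgue_rV A.
Proof.
move=> mA; have := @lebesgue_rV_affine m 1%R c A ltr01 mA.
rewrite expr1n invr1 mul1e => <-; congr lebesgue_rV.
by apply/seteqP; split=> x /=; rewrite scale1r.
Qed.

End lebesgue_rV_measure.

(** * Euclidean balls *)

Section euclidean_norm.
Context {R : realType} {m : nat}.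
Implicit Types (x y a : 'rV[R]_m) (r s : R).

Definition enorm x : R := Num.sqrt (\sum_(i < m) x ord0 i ^+ 2).

Lemma euclidean_ballE a r : euclidean_ball a r = [set x | enorm (x - a) < r].
Proof.
apply/funext => x; rewrite /euclidean_ball/enorm/=.
by under [in RHS]eq_bigr do rewrite !mxE.
Qed.

Let sum_sqr_ge0 x : 0 <= \sum_(i < m) x ord0 i ^+ 2.
Proof. by apply: sumr_ge0 => i _; exact: sqr_ge0. Qed.

Lemma enorm_ge0 x : 0 <= enorm x. Proof. exact: sqrtr_ge0. Qed.

Lemma enorm0 : enorm 0 = 0.
Proof. by rewrite /enorm big1 ?sqrtr0// => i _; rewrite mxE expr0n. Qed.

Lemma enormN x : enorm (- x) = enorm x.
Proof. by rewrite /enorm; under eq_bigr do rewrite mxE sqrrN. Qed.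

Lemma enormZ s x : 0 <= s -> enorm (s *: x) = s * enorm x.
Proof.
move=> s0; rewrite /enorm; under eq_bigr do rewrite mxE exprMn.
by rewrite -mulr_sumr sqrtrM ?sqr_ge0// sqrtr_sqr ger0_norm.
Qed.

Lemma cauchy_schwarz x y : (\sum_(i < m) x ord0 i * y ord0 i) ^+ 2 <=
  (\sum_(i < m) x ord0 i ^+ 2) * (\sum_(i < m) y ord0 i ^+ 2).
Proof.
set A := \sum_i x _ _ ^+ 2; set B := \sum_i _ * _; set C := \sum_i y _ _ ^+ 2.
have [C0|C0] := eqVneq C 0.
  suff -> : B = 0 by rewrite C0 mulr0 expr0n.
  rewrite /B big1// => i _.
  have /eqP := C0; rewrite psumr_eq0 => [/allP/(_ i)|j _]; last exact: sqr_ge0.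
  by rewrite mem_index_enum sqrf_eq0 => /(_ isT)/eqP ->; rewrite mulr0.
have Cgt0 : 0 < C by rewrite lt_def C0 sum_sqr_ge0.
(* Up to the factor [C ^+ 2], this is the squared norm of the component of [x] orthogonal to [y]. *)
have : 0 <= \sum_(i < m) (C * x ord0 i - B * y ord0 i) ^+ 2.
  by apply: sumr_ge0 => i _; exact: sqr_ge0.
suff -> : \sum_(i < m) (C * x ord0 i - B * y ord0 i) ^+ 2 = C * (A * C - B ^+ 2).
  by rewrite pmulr_rge0// subr_ge0.
rewrite (eq_bigr (fun i => C ^+ 2 * x ord0 i ^+ 2 -
  (C * B) *+ 2 * (x ord0 i * y ord0 i) + B ^+ 2 * y ord0 i ^+ 2)).
  by rewrite big_split/= sumrB -!mulr_sumr -/A -/B -/C; ring.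
by move=> i _; ring.
Qed.

Lemma enormD x y : enorm (x + y) <= enorm x + enorm y.
Proof.
rewrite -(@ler_pXn2r _ 2)// ?nnegrE ?addr_ge0 ?enorm_ge0//.
rewrite sqrrD !sqr_sqrtr// -sqrtrM//.
under eq_bigr do rewrite mxE sqrrD.
rewrite !big_split/= lerD2r lerD2l -mulr2n lerMn2r/=.
by rewrite (le_trans (ler_norm _))// -sqrtr_sqr ler_sqrt ?mulr_ge0// cauchy_schwarz.
Qed.

Lemma enormB x y : enorm (x - y) <= enorm x + enorm y.
Proof. by rewrite -(enormN y) enormD. Qed.

Lemma norm_coord_le x i : `|x ord0 i| <= `|x|.
Proof.
rewrite [leRHS]/Num.norm /= mx_normrE; apply/bigmax_geP; right => /=.
by exists (ord0, i).
Qed.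

Lemma norm_le_enorm x : `|x| <= enorm x.
Proof.
rewrite [leLHS]/Num.norm /= mx_normrE; apply/bigmax_leP; split=> [|[i j] _ /=].
  exact: enorm_ge0.
rewrite ord1 -sqrtr_sqr ler_sqrt// (bigD1 j)//= lerDl.
by apply: sumr_ge0 => k _; exact: sqr_ge0.
Qed.

Lemma enorm_le_norm x : enorm x <= m%:R * `|x|.
Proof.
rewrite -(@ler_pXn2r _ 2)// ?nnegrE ?mulr_ge0 ?enorm_ge0//.
rewrite sqr_sqrtr// exprMn (@le_trans _ _ (m%:R * `|x| ^+ 2))//.
  rewrite mulr_natl -[X in _ *+ X](card_ord m) -sumr_const ler_sum// => i _.
  by rewrite -real_normK ?num_real// lerXn2r ?nnegrE// norm_coord_le.
by rewrite ler_wpM2r ?sqr_ge0// -natrX ler_nat; case: (m) => // n; rewrite leq_pmulr.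
Qed.

Lemma open_euclidean_ball a r : open (euclidean_ball a r).
Proof.
rewrite euclidean_ballE openE => x /= xr; apply/nbhs_ballP.
(* The comparison constant of the two norms is [m]; dividing by [m.+1] also covers dimension 0. *)
have e0 : 0 < (r - enorm (x - a)) / m.+1%:R by rewrite divr_gt0 ?subr_gt0.
exists ((r - enorm (x - a)) / m.+1%:R) => //= y.
rewrite -ball_normE /ball_/= ltr_pdivlMr// mulrC => xy.
have -> : y - a = (x - a) - (x - y) by rewrite opprB [RHS]addrC subrKA.
rewrite (le_lt_trans (enormB _ _))// -ltrBrDl.
rewrite (le_lt_trans (enorm_le_norm _))// (le_lt_trans _ xy)//.
by rewrite ler_wpM2r// ler_nat.
Qed.

Lemma measurable_euclidean_ball a r :
  measurable (euclidean_ball a r : set (borel _)).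
Proof. by apply: open_borel; exact: open_euclidean_ball. Qed.

Lemma euclidean_ball_sub a b r s : r + enorm (a - b) <= s ->
  euclidean_ball a r `<=` euclidean_ball b s.
Proof.
rewrite !euclidean_ballE => rs x /= xr.
rewrite -(subrKA a) (le_lt_trans (enormD _ _))//.
by rewrite (lt_le_trans _ rs)// ltrD2r.
Qed.

Lemma euclidean_ball_bounded a r : exists2 C : set 'rV[R]_m, compact C &
  euclidean_ball a r `<=` C.
Proof.
exists [set v : 'rV[R]_m | forall i, `[a ord0 i - r, a ord0 i + r]%classic (v ord0 i)].
  by apply: (@rV_compact _ _ (fun i => `[a ord0 i - r, a ord0 i + r]%classic)) => i;
    exact: segment_compact.
rewrite euclidean_ballE => x /= xr i.
rewrite in_itv/= -ler_distlC distrC (le_trans _ (ltW xr))//.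
by rewrite (le_trans _ (norm_le_enorm _))// (le_trans _ (norm_coord_le _ i))// !mxE.
Qed.

End euclidean_norm.

Section ball_volume.
Context {R : realType} {m : nat}.
Implicit Types (a : 'rV[R]_m) (r s e : R).
Local Notation lam := (@lebesgue_rV R m).

Definition ball_volume r : R := fine (lam (euclidean_ball 0 r)).

Let lam_ball_ltoo r : (lam (euclidean_ball 0 r) < +oo)%E.
Proof.
have r1 : 0 < `|r| + 1 by rewrite ltr_wpDl.
apply: (@le_lt_trans _ _ (lam (ball (0 : 'rV[R]_m) (`|r| + 1)))); last first.
  by rewrite lebesgue_rV_ball0// ltry.
apply: le_measure; rewrite ?inE.
- exact: measurable_euclidean_ball.
- exact: measurable_ball_rV.
- rewrite euclidean_ballE => x /=; rewrite subr0 -ball_normE /ball_/= sub0r normrN.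
  by move=> /(le_lt_trans (norm_le_enorm _))/lt_trans; apply; rewrite ltr_pwDr// ler_norm.
Qed.

Lemma lebesgue_rV_ball a r : lam (euclidean_ball a r) = (ball_volume r)%:E.
Proof.
rewrite /ball_volume fineK; last by rewrite ge0_fin_numE.
rewrite -(@lebesgue_rV_translate _ _ a); last exact: measurable_euclidean_ball.
by congr (lam _); apply/funext => x; rewrite !euclidean_ballE/= addrK subr0.
Qed.

Lemma ball_volume_scale r : 0 < r -> ball_volume r = r ^+ m * ball_volume 1.
Proof.
move=> r0; apply: EFin_inj; rewrite EFinM -2!(lebesgue_rV_ball 0).
have -> : euclidean_ball 0 1 =
    (fun x : 'rV[R]_m => r *: x + 0) @^-1` euclidean_ball 0 r.
  apply/funext => x; rewrite !euclidean_ballE/= addr0 !subr0 enormZ ?ltW//.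
  by rewrite gtr_pMr.
rewrite (lebesgue_rV_affine _ r0); last exact: measurable_euclidean_ball.
by rewrite muleA -EFinM divff ?mul1e// expf_neq0// gt_eqF.
Qed.

Lemma ball_volume_gt0 r : 0 < r -> 0 < ball_volume r.
Proof.
move=> r0; rewrite -lte_fin -(lebesgue_rV_ball 0).
have r1 : 0 < r / m.+1%:R by rewrite divr_gt0.
apply: (@lt_le_trans _ _ (lam (ball (0 : 'rV[R]_m) (r / m.+1%:R)))).
  by rewrite lebesgue_rV_ball0// lte_fin exprn_gt0// mulr_gt0.
apply: le_measure; rewrite ?inE.
- exact: measurable_ball_rV.
- exact: measurable_euclidean_ball.
- rewrite euclidean_ballE => x /=; rewrite subr0 -ball_normE /ball_/= sub0r normrN.
  rewrite ltr_pdivlMr// mulrC; apply: le_lt_trans.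
  by rewrite (le_trans (enorm_le_norm _))// ler_wpM2r// ler_nat.
Qed.

Lemma ball_volume_double r s : 0 < r -> s <= r ->
  ball_volume (r + s) <= 2 ^+ m * ball_volume r.
Proof.
move=> r0 sr; apply: (@le_trans _ _ (ball_volume (2 * r))).
  rewrite -lee_fin -!(lebesgue_rV_ball 0); apply: le_measure; rewrite ?inE;
    try exact: measurable_euclidean_ball.
  by apply: euclidean_ball_sub; rewrite subrr enorm0 addr0 mulr_natl mulr2n lerD2l.
by rewrite ball_volume_scale ?mulr_gt0// (ball_volume_scale r0) exprMn mulrA.
Qed.

(** Scaling turns the relative volume of the shell into [(1 + t) ^+ m - (1 - t) ^+ m] at
    [t = s / r], which tends to 0 with [t]. Translation invariance makes the bound independent of
    [a]. *)
Lemma shell_volume s e : 0 <= s -> 0 < e -> exists r0, [/\ 0 < r0, s < r0 &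
  forall r, r0 <= r -> forall a,
  (lam (euclidean_ball a (r + s) `\` euclidean_ball a (r - s)) <=
     (e * ball_volume r)%:E)%E].
Proof.
move=> s0 e0; pose g (t : R) := (1 + t) ^+ m - (1 - t) ^+ m.
have g0 : g t @[t --> 0] --> g 0.
  apply: cvgB.
    apply: (@continuous_comp _ _ _ (fun t : R => 1 + t) (fun t => t ^+ m));
      last exact: exprn_continuous.
    by apply: cvgD; [exact: cvg_cst|exact: cvg_id].
  apply: (@continuous_comp _ _ _ (fun t : R => 1 - t) (fun t => t ^+ m));
    last exact: exprn_continuous.
  by apply: cvgB; [exact: cvg_cst|exact: cvg_id].
have [d /= d0 gd] : \forall t \near (0 : R), `|g t| < e.
  move/cvgrPdist_lt : g0 => /(_ e e0); apply: filterS => t.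
  by rewrite {1}/g addr0 subr0 subrr sub0r normrN.
(* The summand [s / d] forces [s / r < d], and [s + 1] keeps the inner radius [r - s] positive. *)
exists (s / d + s + 1); split.
- by rewrite ltr_wpDl// addr_ge0// divr_ge0// ltW.
- by rewrite ltr_pwDr// lerDr divr_ge0// ltW.
move=> r r0r a.
have sr : s < r by rewrite (lt_le_trans _ r0r)// ltr_pwDr// lerDr divr_ge0// ltW.
have r0 : 0 < r by rewrite (le_lt_trans s0).
rewrite measureD; try exact: measurable_euclidean_ball; last first.
  by rewrite /= lebesgue_rV_ball ltry.
rewrite setIidr; last first.
  by apply: euclidean_ball_sub; rewrite subrr enorm0 addr0 lerD2l ge0_cp.
rewrite /= !lebesgue_rV_ball -EFinB lee_fin.
rewrite (@ball_volume_scale (r + s)) ?ltr_wpDr// (@ball_volume_scale (r - s)) ?subr_gt0//.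
rewrite (ball_volume_scale r0).
rewrite mulrA -mulrBl ler_pM2r ?ball_volume_gt0//.
have := gd (s / r).
rewrite /= sub0r normrN (ger0_norm (divr_ge0 s0 (ltW r0))).
have -> : s / r < d.
  rewrite ltr_pdivrMr// -ltr_pdivrMl// mulrC (lt_le_trans _ r0r)//.
  by rewrite -addrA ltrDl ltr_wpDl.
move=> /(_ isT)/(le_lt_trans (ler_norm _))/ltW gse.
apply: le_trans (ler_wpM2r (exprn_ge0 m (ltW r0)) gse); rewrite /g.
by rewrite mulrBl -!exprMn !mulrDl !mul1r mulNr divfK ?gt_eqF.
Qed.

End ball_volume.

(** * Lattices in topological groups *)

(* The library's [compact_cover] asks for a pointed space. *)
Lemma compact_finite_subcover (T : topologicalType) (K : set T)
    (I : choiceType) (D : set I) (f : I -> set T) :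
  compact K -> (forall i, D i -> open (f i)) -> K `<=` \bigcup_(i in D) f i ->
  exists2 E : {fset I}, [set` E] `<=` D & K `<=` \bigcup_(i in [set` E]) f i.
Proof.
move=> /compact_near_coveringP cK fo Kf.
(* The filter of properties that hold for all sufficiently large finite subfamilies. Compactness in
   its near-covering form then yields one subfamily for all of [K]. *)
pose F : set_system {fset I} := [set P | exists2 E : {fset I}, [set` E] `<=` D &
  forall E' : {fset I}, [set` E'] `<=` D -> [set` E] `<=` [set` E'] -> P E'].
have FF : Filter F.
  split.
  - by exists fset0 => // i; rewrite /= inE.
  - move=> P Q [E ED PE] [E' E'D QE']; exists (E `|` E')%fset.
      by move=> i /=; rewrite inE => /orP[/ED|/E'D].
    move=> E2 E2D EE2; split; [apply: PE => //|apply: QE' => //].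
      by move=> i iE; apply: EE2; rewrite /= inE; apply/orP; left.
    by move=> i iE; apply: EE2; rewrite /= inE; apply/orP; right.
  - by move=> P Q PQ [E ED PE]; exists E => // E' E'D /PE; auto.
suff: \forall E \near F, K `<=` (fun x => exists2 i, [set` E] i & f i x).
  case=> E ED /(_ E ED (fun _ => id)) KE.
  by exists E => // x /KE [i iE fix_]; exists i.
apply: (cK _ F (fun E x => exists2 i, [set` E] i & f i x) FF) => x Kx.
have [i Di fix_] := Kf _ Kx.
exists (f i, [set E : {fset I} | [set` E] i]) => /=.
  split; first exact: open_nbhs_nbhs (conj (fo _ Di) fix_).
  exists [fset i]%fset => [j|E' E'D]; first by rewrite /= inE => /eqP ->.
  by apply; rewrite /= inE.
by move=> [y E] /= [fiy Ei]; exists i.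
Qed.

Lemma open_setX (T1 T2 : topologicalType) (A : set T1) (B : set T2) :
  open A -> open B -> open (A `*` B).
Proof.
move=> oA oB; apply: openI.
  by apply: (@open_comp _ _ fst) => // x _; exact: cvg_fst.
by apply: (@open_comp _ _ snd) => // x _; exact: cvg_snd.
Qed.

Section topological_group.
Context {M : topologicalZmodType}.
Implicit Types (U V K : set M).

Lemma translation_continuous (a : M) : continuous (fun x : M => x + a).
Proof.
move=> x; apply: (@continuous_comp _ _ _ (fun x => (x, a)) (fun z : M * M => z.1 + z.2)).
  by apply: cvg_pair => /=; [exact: cvg_id|exact: cvg_cst].
exact: add_continuous.
Qed.

Lemma open_translate U (a : M) : open U -> open [set x | U (x + a)].
Proof.
by move=> oU; apply: (@open_comp _ _ (fun x => x + a)) => // x _;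
  exact: translation_continuous.
Qed.

Lemma open_reflect U (a : M) : open U -> open [set x | U (a - x)].
Proof.
move=> oU; apply: (@open_comp _ _ (fun x => a - x)) => // x _.
apply: (@continuous_comp _ _ _ -%R (fun x => a + x)); first exact: opp_continuous.
have -> : (fun x => a + x) = (fun x => x + a) by apply/funext => y; rewrite addrC.
exact: translation_continuous.
Qed.

Lemma nbhs0_sub U : nbhs 0 U ->
  exists V, [/\ open V, V 0 & forall x y, V x -> V y -> U (x - y)].
Proof.
move=> U0; have := @sub_continuous M (0, 0) U.
rewrite /= subr0 => /(_ U0) [[A B] /= [A0 B0] ABU].
exists (A° `&` B°); split; first by apply: openI; exact: open_interior.
  by split; exact: nbhs_singleton (nbhs_interior _).
move=> x y [/interior_subset Ax _] [_ /interior_subset By].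
exact: (ABU (x, y)).
Qed.

Lemma compact_sub K L : compact K -> compact L ->
  compact [set x | exists a b, [/\ K a, L b & x = a - b]].
Proof.
move=> cK cL.
have -> : [set x | exists a b, [/\ K a, L b & x = a - b]] =
    (fun z : M * M => z.1 - z.2) @` (K `*` L).
  apply/seteqP; split=> [x [a [b [Ka Lb ->]]]|x [[a b] [/= Ka Lb] <-]].
    by exists (a, b).
  by exists a, b.
apply: continuous_compact (compact_setX cK cL).
by apply: continuous_subspaceT; exact: sub_continuous.
Qed.

Lemma compact_nbhs (x : M) : locally_compact [set: M] ->
  exists2 K, nbhs x K & compact K.
Proof. by move=> /(_ x I) [K]; rewrite withinET => xK [cK _]; exists K. Qed.

(** Compactness gives a neighbourhood that works for all [y] in [K]. It is intersected with its
    reflection to treat [y] outside [K] with [x + y] in [K]: there the estimate is applied at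
    [x + y] with the shift [- x]. *)
Lemma compact_support_uniform_continuous (R : realType) (g : M -> R) K (e : R) :
  compact K -> continuous g -> (forall x, ~ K x -> g x = 0) -> 0 < e ->
  exists2 V, nbhs 0 V & forall x y, V x -> `|g (x + y) - g y| < e.
Proof.
move=> /compact_near_coveringP cK cg g0 e0.
have : \forall x \near (0 : M), K `<=` (fun y => `|g (x + y) - g y| < e).
  apply: (cK _ (nbhs (0 : M)) (fun x y => `|g (x + y) - g y| < e)) => y Ky.
  have : (fun z : M * M => g (z.2 + z.1) - g z.1) @ (y, 0) --> g (0 + y) - g y.
    apply: cvgB; last first.
      apply: (@continuous_comp _ _ _ (fun z : M * M => z.1) g (y, 0));
      by [exact: cvg_fst|exact: cg].
    apply: (@continuous_comp _ _ _ (fun z : M * M => z.2 + z.1) g (y, 0)); last exact: cg.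
    apply: (@continuous2_cvg _ _ _ _ _ _ (fun z => z.2) (fun z => z.1) +%R).
    - exact: (@add_continuous M (0, y)).
    - exact: cvg_snd.
    - exact: cvg_fst.
  rewrite add0r subrr => /cvgrPdist_lt/(_ e e0); rewrite near_simpl.
  by apply: filterS => z; rewrite sub0r normrN.
move=> nV.
have nV' : \forall x \near (0 : M), K `<=` (fun y => `|g (- x + y) - g y| < e).
  have := @opp_continuous M 0 [set x | K `<=` (fun y => `|g (x + y) - g y| < e)].
  by rewrite oppr0 => /(_ nV).
exists ([set x | K `<=` (fun y => `|g (x + y) - g y| < e)] `&`
        [set x | K `<=` (fun y => `|g (- x + y) - g y| < e)]).
  exact: filterI.
move=> x y [/= gK gKN]; have [Ky|nKy] := pselect (K y); first exact: gK.
have [Kxy|nKxy] := pselect (K (x + y)).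
  by have := gKN _ Kxy; rewrite addKr distrC.
by rewrite !g0// subrr normr0.
Qed.

End topological_group.

Section lattice.
Context {R : realType} {m : nat} {H : topologicalZmodType}.
Variable Lt : zmodClosed ('rV[R]_m * H)%type.
Local Notation X := 'rV[R]_m.
Local Notation G := ('rV[R]_m * H)%type.
Implicit Types (z l : G) (K : set H).

Definition lattice_points z (S : set X) K : set G :=
  [set l | [/\ l \in Lt, S (z.1 + l.1) & K (z.2 + l.2)]].

Hypothesis latL : lattice Lt.

(** Uniform discreteness: since 0 is isolated and subtraction is continuous, every translate of [U]
    times [V] contains at most one lattice point. *)
Lemma lattice_separated : exists U : set X, exists V : set H,
  [/\ open U, U 0, open V, V 0 & forall l x x' y y', l \in Lt ->
    U x -> U x' -> V y -> V y' -> l = (x - x', y - y') -> l = 0].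
Proof.
have [_ [A A0 AL]] : isolated [set` Lt] 0 by apply: latL.1; rewrite /= rpred0.
have [[A1 A2] /= [A10 A20] A12] := A0.
have [U [oU U0 UA]] := @nbhs0_sub X A1 A10.
have [V [oV V0 VA]] := @nbhs0_sub H A2 A20.
exists U, V; split=> // l x x' y y' lL Ux Ux' Vy Vy' lE.
have : (A `&` [set` Lt]) l.
  by split=> //; rewrite lE; apply: A12; split; [exact: UA|exact: VA].
by rewrite AL.
Qed.

(** Cover [C] times [K] by finitely many translates of the separating neighbourhood; each holds
    [z + l] for at most one [l]. The cover does not depend on [z], hence neither does [N]. *)
Lemma lattice_count (C : set X) K : compact C -> compact K ->
  exists N : nat, forall z (E : {fset G}), [set` E] `<=` lattice_points z C K ->
    (#|` E| <= N)%N.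
Proof.
move=> cC cK; have [U [V [oU U0 oV V0 sepUV]]] := lattice_separated.
pose f (w : G) : set G := [set x : X | U (x - w.1)] `*` [set y | V (y - w.2)].
have fo w : open (f w) by apply: open_setX; exact: open_translate.
have [|P _ PC] := @compact_finite_subcover _ (C `*` K) _ [set: G] f
    (compact_setX cC cK) (fun w _ => fo w).
  by move=> w _; exists w => //; split; rewrite /= subrr.
exists #|` P| => z E EL.
have /choice[i iP] l : exists w : G, l \in E -> w \in P /\ f w (z + l).
  have [lE|] := boolP (l \in E); last by exists 0.
  have [_ Cl Kl] := EL _ lE.
  by have [|w wP fw] := PC (z + l); [split|exists w].
have inj_i : {in E &, injective i}.
  move=> l l' lE l'E ill'.
  have [_ [/= Ul Vl]] := iP _ lE; have [_ [/= Ul' Vl']] := iP _ l'E.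
  have [lL _ _] := EL _ lE; have [l'L _ _] := EL _ l'E.
  apply/eqP; rewrite -subr_eq0; apply/eqP.
  apply: (sepUV _ _ _ _ _ _ Ul Ul' Vl Vl'); first by rewrite rpredB.
  have subE (Z : zmodType) (a b c d : Z) : (a + b - d) - (a + c - d) = b - c.
    by rewrite opprB addrA subrK opprD addrA [a + b]addrC addrK.
  by rewrite ill' !subE; case: (l) (l') => [? ?] [].
rewrite -(card_in_imfset imfset_key inj_i).
apply: fsubset_leq_card; apply/fsubsetP => _ /imfsetP[l lE ->].
by have [] := iP _ lE.
Qed.

Lemma finite_lattice_points z (C : set X) K : compact C -> compact K ->
  finite_set (lattice_points z C K).
Proof.
move=> cC cK; have [N NP] := lattice_count cC cK.
apply: contrapT => /(infinite_set_fset N.+1)[E EL].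
by rewrite leqNgt ltnS (NP z).
Qed.

Lemma quotient_latticeP z z' : z - z' \in Lt <->
  \pi_(quotient_topology (Quotient.quot Lt))%qT z = \pi_(_)%qT z'.
Proof.
rewrite Quotient.idealrBE. split=> [/eqP h|h]; first exact: h.
by apply/eqP; exact: h.
Qed.

Lemma lattice_cocompact : locally_compact [set: H] ->
  exists r, exists2 K, compact K &
  forall z, exists2 l, l \in Lt & euclidean_ball 0 r (z.1 - l.1) /\ K (z.2 - l.2).
Proof.
move=> lcH.
have /choice[k kP] (y : H) : exists K, nbhs y K /\ compact K.
  by have [K yK cK] := compact_nbhs y lcH; exists K.
pose Q := quotient_topology (Quotient.quot Lt).
pose O (w : G) : set G := euclidean_ball w.1 1 `*` (k w.2)°.
have oO w : open (O w).
  by apply: open_setX; [exact: open_euclidean_ball|exact: open_interior].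
pose f (w : G) : set Q := [set \pi_Q z | z in O w]%qT.
have fo w : open (f w).
  rewrite /open/= /quotient_open.
  (* The quotient map is open, because the saturation of an open set is the union of its lattice
     translates. *)
  have -> : (\pi_Q @^-1` f w)%qT = \bigcup_(l in [set` Lt]) [set z : G | O w (z - l)].
    apply/seteqP; split=> [z [z' Oz' z'z]|z [l lL Oz]].
      exists (z - z'); last by rewrite /= subKr.
      exact/quotient_latticeP/esym.
    exists (z - l) => //; apply/quotient_latticeP.
    by rewrite addrAC subrr add0r rpredN.
  apply: bigcup_open => l _.
  rewrite [X in open X](_ : _ = [set x : X | euclidean_ball w.1 1 (x - l.1)] `*`
      [set y | (k w.2)° (y - l.2)])//.
  apply: open_setX; apply: open_translate; last exact: open_interior.
  exact: open_euclidean_ball.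
have [_ cQ] := latL.
have [|P _ PQ] := @compact_finite_subcover _ [set: Q] _ [set: G] f cQ (fun w _ => fo w).
  move=> q _; exists (repr q) => //; exists (repr q); last by rewrite reprK.
  split; first by rewrite /= euclidean_ballE /= subrr enorm0.
  by apply: nbhs_singleton; apply: nbhs_interior; have [] := kP (repr q).2.
exists (1 + \sum_(w <- P) enorm w.1); exists (\big[setU/set0]_(w <- P) k w.2).
  by apply: bigsetU_compact => w _; have [] := kP w.2.
move=> z; have [w wP [z' [/= z'1 z'2] z'z]] := PQ (\pi_Q z)%qT I.
exists (z - z').
  exact/quotient_latticeP/esym.
rewrite /= !subKr; split; last first.
  by rewrite -bigcup_fset; exists w => //; exact: interior_subset.
apply: euclidean_ball_sub z'1; rewrite subr0 lerD2l (big_fsetD1 w)//= lerDl.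
by apply: sumr_ge0 => v _; exact: enorm_ge0.
Qed.

Hypothesis denseL : dense (snd @` [set` Lt]).

(** Density provides a suitable lattice vector for each single [y]; compactness of [K] makes
    finitely many of them suffice, and the sum of their norms is a crude common bound [s]. *)
Lemma lattice_approx (V : set H) (K : set H) : nbhs 0 V -> compact K ->
  exists2 s : R, 0 <= s & forall y, K y ->
    exists l, [/\ l \in Lt, V (y - l.2) & enorm l.1 <= s].
Proof.
move=> V0 cK.
pose f (l : G) := [set y | V° (y - l.2)].
have fo l : open (f l) by apply: open_translate; exact: open_interior.
have [|P PL KP] := @compact_finite_subcover _ K _ [set` Lt] f cK (fun l _ => fo l).
  move=> y _; have oV : open [set h | V° (y - h)].
    by apply: open_reflect; exact: open_interior.
  have [|h [Vh [l lL lh]]] := denseL _ oV.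
    by exists y; rewrite /= subrr; exact: nbhs_singleton (nbhs_interior V0).
  by exists l => //; rewrite /f/= lh.
exists (\sum_(l <- P) enorm l.1).
  by apply: sumr_ge0 => v _; exact: enorm_ge0.
move=> y /KP[l lP fl]; exists l; split; first exact: PL.
  exact: interior_subset.
rewrite (big_fsetD1 l)//= lerDl.
by apply: sumr_ge0 => v _; exact: enorm_ge0.
Qed.

End lattice.

(** * Lattice sums *)

Section lattice_sum.
Context {R : realType} {m : nat} {H : topologicalZmodType}.
Variable Lt : zmodClosed ('rV[R]_m * H)%type.
Local Notation X := 'rV[R]_m.
Local Notation G := ('rV[R]_m * H)%type.
Local Notation lam := (@lebesgue_rV R m).
Implicit Types (z l : G) (K : set H) (F : G -> R) (S : set X).

(** This sum takes the default value 0 when infinitely many terms are nonzero. Periodicity holds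
    regardless, by reindexing; for values, [lattice_sum_fset] asks for a finite set that carries the
    support. *)
Definition lattice_sum F z : R := \sum_(l \in [set` Lt]) F (z + l).

Definition lattice_card z S K : R := #|` fset_set (lattice_points Lt z S K)|%:R.

Lemma lattice_sum_periodic F z t : t \in Lt ->
  lattice_sum F (z - t) = lattice_sum F z.
Proof.
move=> tL; rewrite /lattice_sum (@reindex_fsbig _ _ _ _ _ (fun l => l + t) [set` Lt]).
  by apply: eq_fsbigr => l _; rewrite addrA addrAC addrNK.
split=> [l lL|l l' _ _ /addIr//|l lL]; first by rewrite /= rpredD.
by exists (l - t); [rewrite /= rpredB|rewrite subrK].
Qed.

Lemma lattice_sum_fset F z (E : set G) : finite_set E -> E `<=` [set` Lt] ->
  (forall l, l \in Lt -> F (z + l) != 0 -> E l) ->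
  lattice_sum F z = \sum_(l <- fset_set E) F (z + l).
Proof.
move=> fE EL EF; rewrite /lattice_sum -(@fsbig_widen _ _ _ _ E)//.
  exact: fsbig_finite.
by move=> l [lL nEl]; apply: contrapT => /eqP /(EF l lL).
Qed.

Lemma lattice_sum_ge0 F z : (forall z, 0 <= F z) -> 0 <= lattice_sum F z.
Proof. by move=> F0; exact: fsumr_ge0. Qed.

Hypothesis latL : lattice Lt.

Lemma finite_lattice_points_bounded z S (C : set X) K :
  compact C -> compact K -> S `<=` C -> finite_set (lattice_points Lt z S K).
Proof.
move=> cC cK SC; apply: sub_finite_set (finite_lattice_points latL z cC cK).
by move=> l [lL /SC Cl Kl].
Qed.

Lemma finite_lattice_points_ball z a r K :
  compact K -> finite_set (lattice_points Lt z (euclidean_ball a r) K).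
Proof.
by have [C cC rC] := euclidean_ball_bounded a r; move=> cK;
  exact: finite_lattice_points_bounded cC cK rC.
Qed.

(* Double counting: integrate over u the number of lattice points at distance
   less than 1 from u. *)
Lemma lattice_card_volume K : compact K -> exists2 c : R, 0 <= c &
  forall z S (A : set X), measurable (A : set (borel X)) ->
    (forall x, S x -> euclidean_ball x 1 `<=` A) ->
    finite_set (lattice_points Lt z S K) ->
    ((lattice_card z S K)%:E <= c%:E * lam A)%E.
Proof.
move=> cK; have [C cC BC] := @euclidean_ball_bounded R m 0 1.
have [N NP] := lattice_count latL cC cK.
have v1 : 0 < @ball_volume R m 1 by exact: ball_volume_gt0.
exists (N%:R / @ball_volume R m 1); first by rewrite divr_ge0// ltW.
move=> z S A mA SA finS.
set D := fset_set (lattice_points Lt z S K).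
have DP l : l \in D -> lattice_points Lt z S K l.
  by rewrite in_fset_set// inE.
have mB x : measurable (euclidean_ball x 1 : set (borel X)).
  exact: measurable_euclidean_ball.
have : (\sum_(l <- D) lam (euclidean_ball (z.1 + l.1) 1) <= N%:R%:E * lam A)%E.
  under eq_bigr do rewrite -[X in lam X]setIT -integral_indic//.
  rewrite -ge0_integral_sum//; last first.
    by move=> l; exact/measurable_EFinP/measurable_indic.
  rewrite -[X in (_ <= _ * lam X)%E]setIT -integral_indic//.
  rewrite -ge0_integralZl//; last by exact/measurable_EFinP/measurable_indic.
  apply: ge0_le_integral => //.
  - by move=> u _; apply: sume_ge0.
  - apply: emeasurable_sum => l; exact/measurable_EFinP/measurable_indic.
  - by apply: measurable_funeM; exact/measurable_EFinP/measurable_indic.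
  move=> u _; rewrite sumEFin -EFinM lee_fin.
  (* Outside [A] all indicators vanish, as the unit balls around points of [S] lie in [A]. Inside,
     shifting by [u] moves the counted points into the fixed compact [C], where [N] bounds their
     number. *)
  have [uA|uA] := boolP (u \in A); last first.
    rewrite big_seq big1 ?mulr_ge0// => l /DP[_ Sl _].
    rewrite indicE memNset// => /(SA _ Sl) uA'.
    by move/negP : uA; apply; rewrite inE.
  rewrite [X in _ <= _ * X]indicE uA mulr1.
  pose E := [fset l in [seq l <- D | u \in euclidean_ball (z.1 + l.1) 1]]%fset.
  have -> : \sum_(l <- D) \1_(euclidean_ball (z.1 + l.1) 1) u = #|` E|%:R :> R.
    rewrite card_fseq undup_id ?filter_uniq ?fset_uniq// size_filter -sum1_count.
    rewrite natr_sum [RHS]big_mkcond/=; apply: eq_bigr => l _.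
    by rewrite indicE; case: (_ \in _).
  rewrite ler_nat (NP (z.1 - u, z.2))// => l.
  rewrite /= !inE mem_filter => /andP[ul lD].
  have [lL _ Kl] := DP _ lD; split=> //=.
  apply: BC; move/set_mem : ul; rewrite !euclidean_ballE/= subr0 -enormN.
  by rewrite opprB addrAC.
under eq_bigr do rewrite lebesgue_rV_ball.
rewrite sumEFin big_const_seq count_predT iter_addr_0 -[X in X *+ _]mul1r -mulrnAl.
rewrite EFinM => h; rewrite EFinM muleAC.
by rewrite lee_pdivlMr.
Qed.

Definition ball_weight (g : H -> R) a r : G -> R :=
  fun z => \1_(euclidean_ball a r) z.1 * g z.2.

Lemma ball_weight_neq0 (g : H -> R) a r K z :
  (forall y, ~ K y -> g y = 0) -> ball_weight g a r z != 0 ->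
  euclidean_ball a r z.1 /\ K z.2.
Proof.
move=> gK; rewrite /ball_weight mulf_eq0 negb_or indicE => /andP[h g0].
split; first by apply: contrapT => nB; rewrite memNset// eqxx in h.
by apply: contrapT => /gK gz; rewrite gz eqxx in g0.
Qed.

Section bounded_weight.
Variables (g : H -> R) (K : set H) (M : R).
Hypotheses (cK : compact K) (gK : forall y, ~ K y -> g y = 0).
Hypothesis gM : forall y, 0 <= g y <= M.

Let M0 : 0 <= M.
Proof. by have /andP[/le_trans] := gM 0; exact. Qed.

(** Each term is at most [M], and the terms are counted by the volume of the ball enlarged by 1. The
    condition [1 <= r] keeps the enlarged radius below [2 * r], whence the factor [2 ^+ m]. *)
Lemma lattice_sum_bound : exists2 C : R, 0 <= C & forall r a z, 1 <= r ->
  lattice_sum (ball_weight g a r) z <= C * @ball_volume R m r.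
Proof.
have [c c0 cP] := lattice_card_volume cK.
exists (M * (c * 2 ^+ m)); first by rewrite !mulr_ge0// exprn_ge0.
move=> r a z r1; have r0 : 0 < r by rewrite (lt_le_trans _ r1).
have fL := finite_lattice_points_ball z a r cK.
rewrite (lattice_sum_fset fL); last 2 first.
- by move=> l [].
- by move=> l lL /(ball_weight_neq0 gK)[].
apply: (@le_trans _ _ (M * lattice_card z (euclidean_ball a r) K)).
  rewrite /lattice_card mulr_natr -iter_addr_0 -count_predT -big_const_seq.
  apply: ler_sum => l _; have /andP[g0 gleM] := gM (z + l).2.
  by rewrite /ball_weight indicE; case: (_ \in _); rewrite ?mul1r ?mul0r.
rewrite -!mulrA ler_wpM2l//.
have := cP z (euclidean_ball a r) (euclidean_ball a (r + 1))
  (measurable_euclidean_ball _ _) _ fL.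
rewrite lebesgue_rV_ball -EFinM lee_fin => h; apply: le_trans (h _) _.
  move=> x /= xr; apply: euclidean_ball_sub.
  by rewrite euclidean_ballE/= in xr; rewrite addrC lerD2r ltW.
by rewrite ler_wpM2l// ball_volume_double.
Qed.

Hypotheses (lcH : locally_compact [set: H]) (cg : continuous g).
Hypothesis denseL : dense (snd @` [set` Lt]).

(** By periodicity [z] may be replaced by [w = z - t] with [w.2] almost 0 and [w.1] bounded. The
    sums at [w] and at 0 are then compared term by term: lattice points near the sphere are few, and
    at all others inside the ball only [g] varies, by little. *)
Lemma lattice_sum_close (rho : R) (K2 : set H) (e : R) : compact K2 -> 0 < e ->
  exists2 r0 : R, 0 < r0 & forall r a z, r0 <= r -> enorm z.1 <= rho -> K2 z.2 ->
  `|lattice_sum (ball_weight g a r) z - lattice_sum (ball_weight g a r) 0|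
    <= e * @ball_volume R m r.
Proof.
move=> cK2 e0.
have [V0 V0n cV0] := compact_nbhs (0 : H) lcH.
(* Large enough to contain [l.2] whenever [w.2 + l.2] lies in [K] and [w.2] in [V0], and still
   compact. *)
pose K' := [set x | exists a b, [/\ K a, V0 b & x = a - b]].
have cK' : compact K' by exact: compact_sub.
have KK' : K `<=` K'.
  by move=> y Ky; exists y, 0; split=> //; [exact: nbhs_singleton|rewrite subr0].
have [c c0 cP] := lattice_card_volume cK'.
(* The [+ 1] here and in [c2] only keeps the divisors positive. Each of the two error terms is to
   use up half of [e]. *)
pose c1 := c * 2 ^+ m + 1.
have c1_gt0 : 0 < c1 by rewrite ltr_wpDl// mulr_ge0// exprn_ge0.
have e1_gt0 : 0 < e / 2 / c1 by rewrite !divr_gt0.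
have [V Vn gV] := compact_support_uniform_continuous cK cg gK e1_gt0.
have [s s0 sP] := lattice_approx denseL (filterI Vn V0n) cK2.
pose c2 := M * c + 1.
have c2_gt0 : 0 < c2 by rewrite ltr_wpDl// mulr_ge0.
have e2_gt0 : 0 < e / 2 / c2 by rewrite !divr_gt0.
pose s' := `|rho| + s.
have s'0 : 0 <= s' by rewrite addr_ge0.
(* The thickness is [s' + 1] because counting by volume needs a margin of 1 around the shell of
   thickness [s']. *)
have [r0 [r0_gt0 s'r0 shell]] := @shell_volume R m (s' + 1) _ (addr_ge0 s'0 ler01) e2_gt0.
exists r0 => // r a z r0r zrho K2z.
have r_gt0 : 0 < r by rewrite (lt_le_trans r0_gt0).
have [t [tL [Vt V0t] ts]] := sP _ K2z.
rewrite -(lattice_sum_periodic _ z tL).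
pose w := z - t.
have wnorm : enorm w.1 <= s'.
  by rewrite (le_trans (enormB _ _))// lerD// (le_trans zrho)// ler_norm.
rewrite -[z - t]/w.
set Sh := euclidean_ball a (r + s') `\` euclidean_ball a (r - s').
set E := lattice_points Lt 0 (euclidean_ball a (r + s')) K'.
have fE : finite_set E by exact: finite_lattice_points_ball.
have fSh : finite_set (lattice_points Lt 0 Sh K').
  by apply: sub_finite_set fE => l [lL [Bl _] K'l].
have EL : E `<=` [set` Lt] by move=> l [].
rewrite !(lattice_sum_fset fE EL); last 2 first.
- move=> l lL; rewrite add0r => /(ball_weight_neq0 gK)[Bl Kl].
  split=> //; rewrite add0r; last exact: KK'.
  by apply: euclidean_ball_sub Bl; rewrite subrr enorm0 addr0 lerDl.
- move=> l lL /(ball_weight_neq0 gK)[Bl Kl]; split=> //; rewrite add0r.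
    rewrite !euclidean_ballE/= in Bl *.
    have -> : l.1 - a = (w.1 + l.1 - a) - w.1.
      by rewrite -(addrA w.1) addrAC subrr add0r.
    by rewrite (le_lt_trans (enormB _ _))// ltr_leD.
  by exists (w.2 + l.2), w.2; split=> //; rewrite addrC addKr.
rewrite -sumrB (le_trans (ler_norm_sum _ _ _))//.
(* In the shell both values lie in [[0, M]], so they differ by at most [M]. A point of [E] off the
   shell is within [r - s'] of [a], so both indicators equal 1 and uniform continuity of [g]
   applies. *)
apply: (@le_trans _ _ (M * lattice_card 0 Sh K' +
    e / 2 / c1 * lattice_card 0 (euclidean_ball a (r + s')) K')).
  set SL := lattice_points Lt 0 Sh K' in fSh *.
  have -> : lattice_card 0 Sh K' = \sum_(l <- fset_set E) (l \in SL)%:R.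
    have -> : lattice_card 0 Sh K' =
        #|` [fset l in [seq l <- fset_set E | l \in SL]]%fset|%:R.
      congr (#|` _|%:R); apply/fsetP => l.
      rewrite in_fset_set// in_fset /= mem_filter [X in _ && X]in_fset_set//.
      apply/idP/andP => [lSL|[]//]; split=> //.
      by move: lSL; rewrite !inE => -[lL [Bl _] K'l].
    rewrite card_fseq undup_id ?filter_uniq ?fset_uniq// size_filter -sum1_count.
    by rewrite natr_sum big_mkcond/=; apply: eq_bigr => l _; case: (_ \in _).
  rewrite /lattice_card mulr_natr -iter_addr_0 -count_predT -big_const_seq.
  rewrite mulr_sumr -big_split/= !big_seq; apply: ler_sum => l.
  rewrite in_fset_set// inE => -[lL Bl K'l]; rewrite add0r in Bl K'l.
  have [lSL|nlSL] := boolP (l \in SL).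
    rewrite mulr1 (@le_trans _ _ M) ?lerDl ?(ltW e1_gt0)// ler_norml.
    have wM z' : 0 <= ball_weight g a r z' <= M.
      have /andP[g0 gleM] := gM z'.2.
      by rewrite /ball_weight indicE; case: (_ \in _); rewrite ?mul1r ?mul0r ?lexx ?g0.
    have /andP[u0 uM] := wM (w + l); have /andP[v0 vM] := wM (0 + l).
    by apply/andP; split; lra.
  have Bl' : euclidean_ball a (r - s') l.1.
    apply: contrapT => nB; move/negP : nlSL; apply; rewrite inE /SL.
    by split=> //; rewrite add0r; split.
  rewrite mulr0 add0r /ball_weight add0r !indicE !mem_set; last 2 first.
  - by apply: euclidean_ball_sub Bl'; rewrite subrr enorm0 addr0 gerBl.
  - rewrite !euclidean_ballE/= in Bl' *.
    rewrite -addrA (le_lt_trans (enormD _ _))// -ltrBrDl (lt_le_trans Bl')//.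
    by rewrite lerD2l lerN2.
  by rewrite !mul1r ltW// gV.
have h1 : lattice_card 0 Sh K' <= c * (e / 2 / c2 * @ball_volume R m r).
  rewrite -lee_fin EFinM.
  apply: le_trans (cP 0 Sh (euclidean_ball a (r + (s' + 1)) `\`
    euclidean_ball a (r - (s' + 1))) _ _ fSh) _.
  - by apply: measurableD; exact: measurable_euclidean_ball.
  - move=> x [xs xs'] u xu; split.
      apply: euclidean_ball_sub xu; rewrite euclidean_ballE/= in xs.
      by rewrite addrA [leLHS]addrC lerD2r ltW.
    move=> us; apply: xs'; rewrite !euclidean_ballE/= in us xu *.
    have -> : x - a = (u - a) - (u - x) by rewrite opprB [RHS]addrC subrKA.
    rewrite (le_lt_trans (enormB _ _))// -ltrBrDr (lt_le_trans us)//.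
    by rewrite opprD addrA lerD2l lerN2 ltW.
  - by rewrite lee_wpmul2l// shell.
have h2 : lattice_card 0 (euclidean_ball a (r + s')) K' <= c * 2 ^+ m * @ball_volume R m r.
  rewrite -lee_fin EFinM.
  apply: le_trans (cP 0 _ (euclidean_ball a (r + (s' + 1))) _ _ fE) _.
  - exact: measurable_euclidean_ball.
  - move=> x xs; apply: euclidean_ball_sub; rewrite euclidean_ballE/= in xs.
    by rewrite addrA [leLHS]addrC lerD2r ltW.
  - rewrite lebesgue_rV_ball -EFinM lee_fin -mulrA ler_wpM2l// ball_volume_double//.
    by rewrite (le_trans (ltW s'r0)).
apply: (@le_trans _ _ (e / 2 * (M * c / c2) * @ball_volume R m r +
    e / 2 * (c * 2 ^+ m / c1) * @ball_volume R m r)).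
  apply: lerD.
    rewrite (le_trans (ler_wpM2l M0 h1))// le_eqVlt; apply/orP; left; apply/eqP.
    by field; exact: lt0r_neq0.
  rewrite (le_trans (ler_wpM2l (ltW e1_gt0) h2))// le_eqVlt; apply/orP; left; apply/eqP.
  by field; exact: lt0r_neq0.
rewrite -mulrDl ler_wpM2r ?(ltW (ball_volume_gt0 r_gt0))//.
rewrite [leRHS]splitr; apply: lerD; rewrite ler_piMr ?divr_ge0 ?(ltW e0)//.
  by rewrite ler_pdivrMr// mul1r lerDl.
by rewrite ler_pdivrMr// mul1r lerDl.
Qed.

End bounded_weight.

End lattice_sum.

(** * Unfolding over a fundamental domain *)

Section esum_integral.
Local Open Scope ereal_scope.
Context d (Y : measurableType d) {R : realType} {I : choiceType}.
Variables (E : set I) (f : I -> Y -> \bar R).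
Hypotheses (cE : countable E) (mf : forall i, measurable_fun setT (f i)).
Hypothesis f0 : forall i y, 0 <= f i y.

(** One enumeration serves all [g], so the integrand at every point and the sequence of integrals
    become series over the same indices. [P] marks the numbers that code an element of [E]; [i0] is
    a default value. *)
Let esum_nneseries (i0 : I) : exists (e : nat -> I) (P : pred nat),
  forall g : I -> \bar R, (forall i, 0 <= g i) ->
  \esum_(i in E) g i = \sum_(n <oo) (if P n then g (e n) else 0).
Proof.
have /countable_injP[h injh] := cE.
exists ('pinv_(fun=> i0) E h), (fun n => n \in h @` E) => g g0.
rewrite nneseries_esumT; last by move=> n; case: ifP.
rewrite -(esum_mkcond _ (fun n => g ('pinv_(fun=> i0) E h n))).
rewrite (reindex_esum E _ h); first by apply: eq_esum => i Ei; rewrite pinvKV ?inE.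
exact: inj_bij.
Qed.

Lemma emeasurable_esum : measurable_fun setT (fun y => \esum_(i in E) f i y).
Proof.
have [->|/set0P[i0 _]] := eqVneq E set0.
  by under eq_fun do rewrite esum_set0; exact: measurable_cst.
have [e [P eP]] := esum_nneseries i0.
under eq_fun do rewrite eP//.
apply: ge0_emeasurable_sum => [n y _ _|n _]; first by case: ifP.
by case: (P n) => //; exact: measurable_cst.
Qed.

Lemma ge0_integral_esum (mu : {measure set Y -> \bar R}) :
  \int[mu]_y (\esum_(i in E) f i y) = \esum_(i in E) \int[mu]_y f i y.
Proof.
have [->|/set0P[i0 _]] := eqVneq E set0.
  by under eq_integral do rewrite esum_set0; rewrite integral0 esum_set0.
have [e [P eP]] := esum_nneseries i0.
under eq_integral do rewrite eP//.
rewrite eP; last by move=> i; exact: integral_ge0.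
rewrite integral_nneseries//; last 2 first.
- by move=> n; case: (P n) => //; exact: measurable_cst.
- by move=> n y _; case: ifP.
by apply: eq_eseriesr => n _; case: ifP => // _; rewrite integral0.
Qed.

End esum_integral.

Section product_haar.
Context {R : realType} {m : nat} {H : topologicalZmodType}.
Variable theta : {measure set (borel H) -> \bar R}.
Hypothesis haar : haar_measure theta.
Local Notation X := 'rV[R]_m.
Local Notation G := ('rV[R]_m * H)%type.
Local Notation lam := (@lebesgue_rV R m).
Local Notation nu := (lam \x^ theta)%E.
Local Open Scope ereal_scope.

Lemma haar_translate (c : H) (A : set (borel H)) : measurable A ->
  theta ((fun y : H => y + c)%R @^-1` A) = theta A.
Proof.
move=> mA; have [_ _ thetaD _ _] := haar; rewrite -(thetaD (- c)%R _ mA).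
congr (theta _); apply/seteqP; split=> [y Ay|_ [y Ay <-]].
  by exists (y + c)%R => //; rewrite addrC addrK.
by rewrite /= addrAC addNr add0r.
Qed.

Lemma measurable_translate (c : G) : measurable_fun setT
  ((fun z : G => z + c)%R : borel X * borel H -> borel X * borel H).
Proof.
apply: measurable_fun_pair.
  by apply: (measurableT_comp (continuous_borel (@translation_continuous X c.1)));
    exact: measurable_fst.
by apply: (measurableT_comp (continuous_borel (@translation_continuous H c.2)));
  exact: measurable_snd.
Qed.

(** [nu] integrates over [H] the Lebesgue measure of sections in [R^m]. The shift by [c.1] is
    absorbed in each section, the shift by [c.2] in the outer integral. *)
Lemma product_haar_translate (c : G) (A : set (borel X * borel H)) : measurable A ->
  nu ((fun z : G => z + c)%R @^-1` A) = nu A.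
Proof.
move=> mA; pose phi (y : borel H) := lam (ysection A y).
have mphi : measurable_fun setT phi.
  by apply: measurable_fun_ysection => //; rewrite inE.
have mtr : measurable_fun setT ((fun y : H => y + c.2)%R : borel H -> borel H).
  exact: continuous_borel (@translation_continuous H c.2).
transitivity (\int[theta]_y phi (y + c.2)%R).
  apply: eq_integral => y _ /=; rewrite /phi.
  rewrite -[RHS](lebesgue_rV_translate c.1); last exact: measurable_ysection.
  congr lebesgue_rV; apply/seteqP; split=> x; rewrite /ysection/= !inE.
transitivity (\int[pushforward_measure theta mtr]_y phi y).
  by rewrite [RHS](ge0_integral_pushforward mtr).
by apply: eq_measure_integral => B mB _; exact: haar_translate.
Qed.

Lemma integral_translate (c : G) (f : borel X * borel H -> \bar R) :
  measurable_fun setT f -> (forall z, 0 <= f z) ->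
  \int[nu]_z f (z + c : G)%R = \int[nu]_z f z.
Proof.
move=> mf f0.
transitivity (\int[pushforward_measure nu (measurable_translate c)]_z f z).
  by rewrite [RHS](ge0_integral_pushforward (measurable_translate c)).
by apply: eq_measure_integral => B mB _; exact: product_haar_translate.
Qed.

Lemma integral_unfold (E : set G) (A B : borel X * borel H -> \bar R) :
  countable E -> measurable_fun setT A -> measurable_fun setT B ->
  (forall z, 0 <= A z) -> (forall z, 0 <= B z) ->
  \int[nu]_z (\esum_(l in E) (A z * B (z + l : G)%R)) =
  \int[nu]_z (\esum_(l in E) (A (z - l : G)%R * B z)).
Proof.
move=> cE mA mB A0 B0.
have mtr (f : borel X * borel H -> \bar R) c : measurable_fun setT f ->
    measurable_fun setT (fun z : borel X * borel H => f (z + c : G)%R).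
  by move=> mf; exact: measurableT_comp mf (measurable_translate c).
have m1 (l : G) : measurable_fun setT (fun z : borel X * borel H => A z * B (z + l : G)%R).
  by apply: emeasurable_funM => //; exact: mtr.
have m2 (l : G) : measurable_fun setT (fun z : borel X * borel H => A (z - l : G)%R * B z).
  by apply: emeasurable_funM => //; exact: mtr.
rewrite (ge0_integral_esum cE m1); last by move=> l z; rewrite mule_ge0.
rewrite (ge0_integral_esum cE m2); last by move=> l z; rewrite mule_ge0.
apply: eq_esum => l _.
rewrite -[RHS](integral_translate l (m2 l)); last by move=> z; rewrite mule_ge0.
by apply: eq_integral => z _; rewrite addrK.
Qed.

End product_haar.

Lemma eq_esum_support (R : realType) (I : choiceType) (E E' : set I)
    (f : I -> \bar R) : (forall i, f i != 0%E -> E i <-> E' i) ->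
  \esum_(i in E) f i = \esum_(i in E') f i.
Proof.
move=> EE'; rewrite esum_mkcond [RHS]esum_mkcond; apply: eq_esum => i _.
have [->|/EE' EE'i] := eqVneq (f i) 0%E; first by rewrite !if_same.
by rewrite (_ : (i \in E) = (i \in E'))//; apply/idP/idP; rewrite !inE => /EE'i.
Qed.

Lemma compact_borel (M : topologicalZmodType) (K : set M) :
  hausdorff_space M -> compact K -> measurable (K : set (borel M)).
Proof. by move=> hM cK; apply: closed_borel; exact: compact_closed. Qed.

Section domain.
Context {R : realType} {m : nat} {H : topologicalZmodType}.
Variable Lt : zmodClosed ('rV[R]_m * H)%type.
Variable theta : {measure set (borel H) -> \bar R}.
Variable T : set (borel 'rV[R]_m * borel H).
Hypotheses (haar : haar_measure theta) (hausH : hausdorff_space H).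
Hypotheses (latL : lattice Lt) (lcH : locally_compact [set: H]).
Hypothesis domT : fundamental_domain Lt T.
Local Notation X := 'rV[R]_m.
Local Notation G := ('rV[R]_m * H)%type.
Local Notation lam := (@lebesgue_rV R m).
Local Notation nu := (lam \x^ theta)%E.
Local Open Scope ereal_scope.

(** The unfolding identity. Measurability is claimed on [T] only, because the passage from the
    lattice to a countable index set is valid at points of [T]. *)
Lemma integral_domain (a : X) (r : R) (K : set H) (B : borel X * borel H -> \bar R) :
  compact K -> measurable_fun setT B -> (forall z, 0 <= B z) ->
  (forall z : G, B z != 0 -> euclidean_ball a r z.1 /\ K z.2) ->
  measurable_fun T (fun z : borel X * borel H => \esum_(l in [set` Lt]) B (z + l : G)%R) /\
  \int[nu]_(z in T) (\esum_(l in [set` Lt]) B (z + l : G)%R) = \int[nu]_z B z.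
Proof.
move=> cK mB B0 BK; have [mT [C cC TC] Tex] := domT.
(* If [z] is in [T] and [B (z + l)] is nonzero, then [l.2] lies in [K - C n] for some [n]; the balls
   of integer radius cut this into finite pieces, so [E] is countable. *)
pose E := \bigcup_n \bigcup_j lattice_points Lt (0 : G)%R (euclidean_ball 0%R j%:R)
  [set x | exists a b, [/\ K a, C n b & x = (a - b)%R]].
have EL : E `<=` [set` Lt] by move=> l [n _ [j _ []]].
have cE : countable E.
  apply: bigcup_countable => // n _; apply: bigcup_countable => // j _.
  by apply: finite_set_countable; apply: finite_lattice_points_ball => //;
    exact: compact_sub.
have inE (l t z : G) : l \in Lt -> T t -> K z.2 -> (z - t)%R = l -> E l.
  move=> lL Tt Kz ztl; have [n _ Cnt] := TC _ Tt.
  exists n => //; exists (Num.truncn (enorm l.1)).+1 => //; split=> //.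
    by rewrite euclidean_ballE/= add0r subr0 real_truncnS_gt ?num_real.
  by rewrite add0r; exists z.2, t.2; split=> //; rewrite -ztl.
pose A (z : borel X * borel H) : \bar R := (\1_T z)%:E.
have mA : measurable_fun setT A by exact/measurable_EFinP/measurable_indic.
have A0 z : 0 <= A z by rewrite lee_fin.
have EE z : T z -> \esum_(l in [set` Lt]) B (z + l : G)%R =
    \esum_(l in E) (A z * B (z + l : G)%R).
  move=> Tz; under [RHS]eq_esum do rewrite /A indicE mem_set// mul1e.
  apply: eq_esum_support => l /BK[_ Kzl]; split=> [lL|/EL//].
  by apply: (inE _ z (z + l)%R) => //; rewrite addrAC subrr add0r.
have mE : measurable_fun setT (fun z : borel X * borel H =>
    \esum_(l in E) (A z * B (z + l : G)%R)).
  apply: emeasurable_esum => // [l|l z]; last by rewrite mule_ge0.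
  by apply: emeasurable_funM => //; exact: measurableT_comp mB (measurable_translate l).
split.
  apply: eq_measurable_fun (measurable_funTS mE) => z /set_mem Tz.
  by rewrite EE.
transitivity (\int[nu]_z (\esum_(l in E) (A z * B (z + l : G)%R))).
  rewrite [LHS]integral_mkcond; apply: eq_integral => z _; rewrite patchE.
  case: ifPn => [/set_mem Tz|nTz]; first exact: EE.
  by rewrite esum1// => l _; rewrite /A indicE (negbTE nTz) mul0e.
rewrite integral_unfold//; apply: eq_integral => z _.
have [Bz|Bz] := eqVneq (B z) 0; first by rewrite Bz esum1// => l _; rewrite mule0.
(* Exactly one lattice vector, [z - t], translates [z] back into [T], so a single term survives. *)
have [_ Kz] := BK _ Bz; have [t [[Tt tL] tuniq]] := Tex z.
rewrite (@eq_esum_support _ _ _ [set (z - t : G)%R]).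
  rewrite esum_set1; first by rewrite /A indicE subKr mem_set// mul1e.
  by rewrite mule_ge0.
move=> l; rewrite mule_eq0 negb_or => /andP[Azl _]; split=> [El|->]; last first.
  exact: (inE _ t z).
have Tzl : T (z - l)%R.
  by apply: contrapT => nT; move: Azl; rewrite /A indicE memNset// eqxx.
by rewrite /= (tuniq (z - l)%R) ?subKr//; split=> //; rewrite ?subKr; exact: EL.
Qed.

Lemma compact_rectangle_finite (r : R) (K : set H) : compact K ->
  nu (euclidean_ball (0 : X)%R r `*` K) < +oo.
Proof.
move=> cK; have [_ thetaK _ _ _] := haar.
rewrite product_measure2E; [|exact: measurable_euclidean_ball|exact: compact_borel].
by rewrite /= lebesgue_rV_ball lte_mul_pinfty// ?lee_fin ?fine_ge0// thetaK.
Qed.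

Let integral_domain_rectangle (r : R) (K : set H) : compact K ->
  let F (z : borel X * borel H) := \esum_(l in [set` Lt])
    (\1_(euclidean_ball (0 : X)%R r `*` K) (z + l : G)%R)%:E in
  measurable_fun T F /\
  \int[nu]_(z in T) F z = nu (euclidean_ball (0 : X)%R r `*` K).
Proof.
move=> cK /=.
have mrK : measurable (euclidean_ball (0 : X)%R r `*` K : set (borel X * borel H)).
  by apply: measurableX; [exact: measurable_euclidean_ball|exact: compact_borel].
pose B (z : borel X * borel H) : \bar R := (\1_(euclidean_ball (0 : X)%R r `*` K) z)%:E.
have mB : measurable_fun setT B by exact/measurable_EFinP/measurable_indic.
have [z||? ->] := @integral_domain 0%R r K B cK mB.
- by rewrite lee_fin.
- move=> z; rewrite /B indicE; have [/set_mem[]//|_] := boolP (z \in _).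
  by rewrite eqxx.
by split=> //; rewrite integral_indic// setIT.
Qed.

(** By cocompactness every point has a lattice translate in one fixed rectangle over a compact set.
    The periodised indicator of this rectangle is thus at least 1, and its integral over [T] is the
    finite measure of the rectangle. *)
Lemma domain_finite : nu T < +oo.
Proof.
have [mT _ _] := domT.
have [r [K cK LrK]] := lattice_cocompact latL lcH.
apply: le_lt_trans (compact_rectangle_finite r cK).
have [mF <-] := integral_domain_rectangle r cK.
rewrite -[leLHS]mul1e -integral_cst//; apply: ge0_le_integral => // z Tz; have [l lL zl] := LrK z.
apply: esum_ge; exists [set (- l : G)%R].
  by split=> // _ ->; rewrite /= rpredN.
by rewrite fsbig_set1 indicE mem_set.
Qed.

(** If [T] were null, unfolding would make every rectangle over a compact set null, hence every
    compact subset of [H]; inner regularity on the open set [H] would then give [theta setT = 0]. *)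
Lemma domain_gt0 : 0 < nu T.
Proof.
have [mT _ _] := domT.
rewrite lt0e measure_ge0 andbT; apply/eqP => nuT0.
have [theta0 _ _ _ inner] := haar.
move/negP : theta0; apply; rewrite eq_le measure_ge0 andbT inner; last exact: openT.
apply: ge_ereal_sup => _ [K [cK _] <-].
have [mF] := integral_domain_rectangle 1%R cK.
rewrite null_set_integral// product_measure2E;
  [|exact: measurable_euclidean_ball|exact: compact_borel].
rewrite /= lebesgue_rV_ball => /esym/eqP; rewrite mule_eq0 eqe.
by rewrite gt_eqF ?ball_volume_gt0//= => /eqP ->.
Qed.

End domain.

(** * Equidistribution *)

Lemma ge0_integral_mrestr d (Y : measurableType d) (R : realType)
    (mu : {measure set Y -> \bar R}) (D : set Y) (mD : measurable D)
    (h : Y -> \bar R) : measurable_fun setT h -> (forall y, (0 <= h y)%E) ->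
  (\int[mrestr mu mD]_y h y = \int[mu]_(y in D) h y)%E.
Proof.
move=> mh h0.
transitivity (\int[mrestr mu mD]_(y in D) h y)%E; last first.
  apply: eq_measure_integral => A mA AD.
  by rewrite /= /mrestr setIidl.
rewrite (@ge0_negligible_integral _ _ _ _ setT (~` D))//; last 2 first.
- exact: measurableC.
- by rewrite /= /mrestr setICl measure0.
by rewrite setTD setCK.
Qed.

Lemma continuous_compact_support_bounded (R : realType) (H : topologicalZmodType)
    (g : H -> R) (K : set H) : compact K -> continuous g ->
  (forall y, ~ K y -> g y = 0) -> exists M, forall y, `|g y| <= M.
Proof.
move=> cK cg gK.
have /compact_bounded[M [_ MP]] :=
  continuous_compact (continuous_subspaceT cg) cK.
exists (Num.max (M + 1) 0) => y; have [Ky|/gK ->] := pselect (K y); last first.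
  by rewrite normr0 le_max lexx orbT.
by rewrite le_max (MP (M + 1))// ?ltrDl//; exists y.
Qed.

Section equidistribution.
Context {R : realType} {m : nat} {H : topologicalZmodType}.
Variable Lt : zmodClosed ('rV[R]_m * H)%type.
Variable theta : {measure set (borel H) -> \bar R}.
Variable T : set (borel 'rV[R]_m * borel H).
Hypotheses (haar : haar_measure theta) (hausH : hausdorff_space H).
Hypotheses (latL : lattice Lt) (lcH : locally_compact [set: H]).
Hypothesis domT : fundamental_domain Lt T.
Local Notation X := 'rV[R]_m.
Local Notation G := ('rV[R]_m * H)%type.
Local Notation lam := (@lebesgue_rV R m).
Local Notation nu := (lam \x^ theta)%E.

(** Replaces Tonelli's theorem: the image under [snd] of [nu] restricted to [B] times [H] is [lam B]
    times [theta], which is checked on rectangles. *)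
Lemma integral_rectangle (B : set (borel X)) (h : borel H -> \bar R) :
  measurable B -> (lam B < +oo)%E -> measurable_fun setT h -> (forall y, 0 <= h y)%E ->
  (\int[nu]_z ((\1_B z.1)%:E * h z.2) = lam B * \int[theta]_y h y)%E.
Proof.
move=> mB Boo mh h0.
have mBT : measurable (B `*` setT : set (borel X * borel H)) by exact: measurableX.
have mh2 : measurable_fun setT (fun z : borel X * borel H => h z.2).
  exact: measurableT_comp mh measurable_snd.
have lamB : lam B = (fine (lam B))%:E by rewrite fineK// ge0_fin_numE.
have B0 : 0 <= fine (lam B) by exact: fine_ge0.
transitivity (\int[nu]_(z in B `*` setT) h z.2)%E.
  rewrite [RHS]integral_mkcond; apply: eq_integral => z _.
  rewrite patchE in_setX in_setT andbT indicE.
  by case: (_ \in _); rewrite ?mul1e ?mul0e.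
rewrite -(ge0_integral_mrestr _ mBT)//.
transitivity (\int[pushforward_measure (mrestr nu mBT) measurable_snd]_y h y)%E.
  by rewrite [RHS](ge0_integral_pushforward measurable_snd).
rewrite (eq_measure_integral (mscale (NngNum B0) theta)).
  by rewrite ge0_integral_mscale//= -lamB.
move=> A mA _; rewrite /= /pushforward /mrestr/= /mscale/= -lamB -product_measure2E//.
by congr (nu _); apply/seteqP; split=> [[x y] [/= Ay [Bx _]]|[x y] [/= Bx Ay]].
Qed.

(** Continuity from above for the decreasing sets [T] minus [S n], which needs [nu T] finite. They
    have empty intersection because [T] lies over the union of the compact sets [C n]. *)
Lemma domain_truncate (e : R) : 0 < e ->
  exists (rho : R) (K : set H) (T' : set (borel X * borel H)),
  [/\ compact K, measurable T', T' `<=` T,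
      forall z, T' z -> enorm z.1 <= rho /\ K z.2 & (nu (T `\` T') <= e%:E)%E].
Proof.
move=> e0; have [mT [C cC TC] _] := domT.
pose U n := \bigcup_(i in `I_n) C i.
have cU n : compact (U n) by rewrite /U bigcup_mkord; exact: bigsetU_compact.
pose S n := euclidean_ball (0 : X) n%:R `*` U n : set (borel X * borel H).
have mS n : measurable (S n).
  by apply: measurableX; [exact: measurable_euclidean_ball|exact: compact_borel].
have : nu \o (fun n => T `\` S n) @ \oo --> nu (\bigcap_n (T `\` S n)).
  apply: nonincreasing_cvg_mu.
  - apply: le_lt_trans (domain_finite haar hausH latL lcH domT).
    by apply: le_measure; rewrite ?inE; [exact: measurableD| |exact: subDsetl].
  - by move=> n; exact: measurableD.
  - by apply: bigcapT_measurable => n; exact: measurableD.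
  - move=> n k nk; apply/subsetPset => z [Tz nS]; split=> // -[/= zn [i /= ni Ci]].
    apply: nS; split=> /=.
      by apply: euclidean_ball_sub zn; rewrite subrr enorm0 addr0 ler_nat.
    by exists i => //=; exact: leq_trans ni nk.
have -> : \bigcap_n (T `\` S n) = set0.
  rewrite -subset0 => z zS; have [Tz _] := zS 0 I; have [n _ Cn] := TC _ Tz.
  (* [n.+1], since [U k] collects the indices strictly below [k]. *)
  pose k := (maxn n.+1 (Num.truncn (enorm z.1)).+1).
  have [_] := zS k I; apply; split=> /=.
    rewrite euclidean_ballE/= subr0 (lt_le_trans (real_truncnS_gt (num_real _)))//.
    by rewrite ler_nat leq_maxr.
  by exists n => //=; exact: leq_maxl.
rewrite measure0 => /fine_cvgP[[N1 _ fS]] /cvgrPdist_lt/(_ e e0)[N2 _ NP].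
pose N := maxn N1 N2; exists N%:R, (U N), (T `&` S N); split.
- exact: cU.
- exact: measurableI.
- exact: subIsetl.
- by move=> z [_ [/= zN UN]]; split=> //; move: zN; rewrite euclidean_ballE/= subr0 => /ltW.
- rewrite setDIr setDv set0U.
  have := NP N (leq_maxr _ _); rewrite /= sub0r normrN => /ltW.
  have fN : nu (T `\` S N) \is a fin_num by apply: fS; exact: leq_maxl.
  by rewrite -[X in (X <= _)%E]fineK// lee_fin; apply: le_trans; exact: ler_norm.
Qed.

Lemma compact_support_integrable (g : H -> R) (K : set H) : compact K ->
  (forall y, ~ K y -> g y = 0) -> continuous g ->
  theta.-integrable setT (EFin \o (g : borel H -> R)).
Proof.
move=> cK gK cg; have [M gM] := continuous_compact_support_bounded cK cg gK.
have mg : measurable_fun setT (EFin \o (g : borel H -> R)).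
  by apply/measurable_EFinP; exact: continuous_borel_real.
have M0 : 0 <= M by rewrite (le_trans _ (gM 0)).
have [_ thetaK _ _ _] := haar.
have mK : measurable (K : set (borel H)) by exact: compact_borel.
apply/integrableP; split=> //.
apply: (@le_lt_trans _ _ (\int[theta]_y (M%:E * (\1_K y)%:E))%E).
  apply: ge0_le_integral => //; first exact: measurableT_comp.
    by apply: measurable_funeM; exact/measurable_EFinP/measurable_indic.
  move=> y _; rewrite -EFinM lee_fin indicE; have [Ky|nKy] := pselect (K y).
    by rewrite mem_set// mulr1.
  by rewrite memNset// mulr0 gK// normr0.
rewrite ge0_integralZl//; last by exact/measurable_EFinP/measurable_indic.
by rewrite integral_indic// setIT lte_mul_pinfty// ?lee_fin// thetaK.
Qed.

Section weight.
Variables (g : H -> R) (K : set H) (M : R).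
Hypotheses (cK : compact K) (gK : forall y, ~ K y -> g y = 0).
Hypotheses (gM : forall y, 0 <= g y <= M) (cg : continuous g).
Hypothesis denseL : dense (snd @` [set` Lt]).

Let weight_ge0 (a : X) r (z : G) : 0 <= ball_weight g a r z.
Proof. by rewrite /ball_weight mulr_ge0//; have /andP[] := gM z.2. Qed.

Let mg : measurable_fun setT (fun y : borel H => (g y)%:E).
Proof. by apply/measurable_EFinP; exact: continuous_borel_real. Qed.

Let integral_fin : (\int[theta]_y (g y)%:E)%E \is a fin_num.
Proof. exact: integrable_fin_num (compact_support_integrable cK gK cg). Qed.

Lemma integral_lattice_sum (a : X) (r : R) :
  measurable_fun T (fun z => (lattice_sum Lt (ball_weight g a r) z)%:E) /\
  (\int[nu]_(z in T) (lattice_sum Lt (ball_weight g a r) z)%:E =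
    (@ball_volume R m r * \int[theta]_y g y)%:E)%E.
Proof.
pose B (z : borel X * borel H) := (ball_weight g a r z)%:E.
have mB : measurable_fun setT B.
  have m1 : measurable_fun setT (fun z : borel X * borel H =>
      (\1_(euclidean_ball a r) z.1)%:E : \bar R).
    have mi : measurable_fun setT (fun x : borel X =>
        (\1_(euclidean_ball a r) x)%:E : \bar R).
      by apply/measurable_EFinP/measurable_indic; exact: measurable_euclidean_ball.
    exact: measurableT_comp mi measurable_fst.
  have -> : B = (fun z : borel X * borel H =>
      (\1_(euclidean_ball a r) z.1)%:E * (g z.2)%:E)%E.
    by apply/funext => z; rewrite -EFinM.
  by apply: emeasurable_funM => //; exact: measurableT_comp mg measurable_snd.
have BK z : B z != 0%E -> euclidean_ball a r z.1 /\ K z.2.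
  by rewrite eqe => /(ball_weight_neq0 gK).
have sumE (z : G) : (lattice_sum Lt (ball_weight g a r) z)%:E =
    \esum_(l in [set` Lt]) B (z + l : G).
  have fL := finite_lattice_points_ball latL z a r cK.
  rewrite (lattice_sum_fset fL); last 2 first.
  - by move=> l [].
  - by move=> l lL /(ball_weight_neq0 gK)[].
  rewrite (@eq_esum_support _ _ _ (lattice_points Lt z (euclidean_ball a r) K)).
    by rewrite esum_fset//; [rewrite fsbig_finite//= sumEFin|move=> l _; rewrite lee_fin].
  by move=> l /BK[Bl Kl]; split=> [//|[]].
have [|mF FE] := @integral_domain _ _ _ _ _ _ haar latL domT a r K B cK mB _ BK.
  by move=> z; rewrite lee_fin.
split; first by under eq_fun do rewrite sumE.
under eq_integral do rewrite sumE.
rewrite FE /B /ball_weight; under eq_integral do rewrite EFinM.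
rewrite (integral_rectangle (h := fun y => (g y)%:E))//.
- by rewrite lebesgue_rV_ball EFinM [in RHS](fineK integral_fin).
- exact: measurable_euclidean_ball.
- by rewrite lebesgue_rV_ball ltry.
- by move=> y; rewrite lee_fin; have /andP[] := gM y.
Qed.


Lemma equidistribution_ge0 (e : R) : 0 < e -> exists2 r0 : R, 0 < r0 &
  forall r (a : X), r0 <= r ->
  `|(fine (nu T))^-1 * \int[theta]_y g y
    - (@ball_volume R m r)^-1 * lattice_sum Lt (ball_weight g a r) 0| <= e.
Proof.
move=> e0; have [mT _ _] := domT.
have Toof : nu T \is a fin_num.
  by rewrite ge0_fin_numE ?measure_ge0//; exact: (domain_finite haar hausH latL lcH domT).
have tau0 : 0 < fine (nu T).
  by apply: fine_gt0; apply/andP; split;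
    [exact: (domain_gt0 haar hausH latL domT)|
     exact: (domain_finite haar hausH latL lcH domT)].
have nuTE : nu T = (fine (nu T))%:E by rewrite fineK.
set tau := fine (nu T) in tau0 nuTE *; set J := \int[theta]_y g y.
have [C C0 CP] := lattice_sum_bound latL cK gK gM.
have C1 : 0 < C + 1 by rewrite ltr_wpDl.
(* With this tolerance the discarded part of [T], where sums are at most [C * v], costs at most
   [e / 2 * v * tau]: half of the admissible error. *)
have d0 : 0 < e / 2 * tau / (C + 1) by rewrite !(divr_gt0, mulr_gt0).
have [rho [K2 [T' [cK2 mT' T'T T'K2 nuT']]]] := domain_truncate d0.
have e20 : 0 < e / 2 by rewrite divr_gt0.
have [r1 r10 close] := lattice_sum_close latL cK gK gM lcH cg denseL rho cK2 e20.
(* The [+ 1] gives [1 <= r], as [lattice_sum_bound] requires. *)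
exists (r1 + 1); first by rewrite addr_gt0.
move=> r a r1r.
have rr1 : r1 <= r by rewrite (le_trans _ r1r)// lerDl.
have r_ge1 : 1 <= r by rewrite (le_trans _ r1r)// lerDr ltW.
have r_gt0 : 0 < r by rewrite (lt_le_trans _ r_ge1).
have v0 : 0 < @ball_volume R m r by exact: ball_volume_gt0.
have [mu_ uJ] := integral_lattice_sum a r.
set v := @ball_volume R m r in v0 uJ *.
set u := lattice_sum Lt (ball_weight g a r) in mu_ uJ *.
set Q := T `\` T'; have mQ : measurable Q by exact: measurableD.
have u0 z : 0 <= u z by exact: lattice_sum_ge0.
have uC z : u z <= C * v by exact: CP.
have Q0 z : 0 <= C * v * \1_Q z by rewrite !mulr_ge0// ltW.
(* On [T'] the two sums are close. On [Q] both lie between 0 and [C * v], so their distance is at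
   most [C * v]. *)
have key z : T z -> `|u z - u 0| <= e / 2 * v + C * v * \1_Q z.
  move=> Tz; have [T'z|nT'z] := pselect (T' z).
    have [zrho K2z] := T'K2 _ T'z.
    by rewrite (le_trans (close _ _ _ rr1 zrho K2z))// lerDl.
  rewrite indicE mem_set// mulr1; apply: ler_wpDl.
    by rewrite mulr_ge0// ltW.
  rewrite ler_norml; have := u0 z; have := uC z; have := u0 0; have := uC 0.
  by move=> *; apply/andP; split; lra.
have mind : measurable_fun T (fun z => (C * v * \1_Q z)%:E).
  apply/measurable_EFinP; apply: measurable_funM; first exact: measurable_cst.
  exact: measurable_indic.
have intQ (c : R) : 0 <= c ->
    (\int[nu]_(z in T) (c%:E + (C * v * \1_Q z)%:E) <=
      (c * tau + C * v * (e / 2 * tau / (C + 1)))%:E)%E.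
  move=> c0; rewrite ge0_integralD//; last by move=> z _; rewrite lee_fin.
  rewrite integral_cst// EFinD EFinM -nuTE leeD2l//.
  under eq_integral do rewrite EFinM.
  have Cv0 : 0 <= C * v by rewrite mulr_ge0// ltW.
  rewrite ge0_integralZl//; last first.
    by apply/measurable_EFinP; exact: measurable_indic.
  rewrite integral_indic// setIidl; last exact: subDsetl.
  by rewrite [leRHS]EFinM lee_wpmul2l.
(* The two halves of [key] are integrated over [T] separately, with all terms on the side where they
   are added, so that only nonnegative integrands occur. *)
have up : v * J <= (u 0 + e / 2 * v) * tau + C * v * (e / 2 * tau / (C + 1)).
  rewrite -lee_fin -uJ; apply: le_trans (intQ _ _).
    apply: ge0_le_integral => //.
    - by move=> z _; rewrite lee_fin.
    - exact: emeasurable_funD.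
    move=> z Tz; rewrite -EFinD lee_fin.
    by have := key z Tz; rewrite ler_norml => /andP[_]; lra.
  by rewrite addr_ge0// mulr_ge0// ltW.
have lo : u 0 * tau <= v * J + e / 2 * v * tau + C * v * (e / 2 * tau / (C + 1)).
  rewrite -addrA -lee_fin EFinD -uJ EFinM -nuTE.
  rewrite -integral_cst//.
  apply: (@le_trans _ _ (\int[nu]_(z in T) ((u z)%:E +
      ((e / 2 * v)%:E + (C * v * \1_Q z)%:E)))%E).
    apply: ge0_le_integral => //.
    - by move=> z _; rewrite lee_fin.
    - by apply: emeasurable_funD => //; exact: emeasurable_funD.
    move=> z Tz; rewrite -!EFinD lee_fin.
    by have := key z Tz; rewrite ler_norml => /andP[+ _]; lra.
  rewrite ge0_integralD//; last 3 first.
  - by move=> z _; rewrite lee_fin.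
  - by move=> z _; rewrite -EFinD lee_fin addr_ge0// mulr_ge0// ltW.
  - exact: emeasurable_funD.
  rewrite leeD2l//; apply: intQ.
  by rewrite mulr_ge0// ltW.
have small : C * v * (e / 2 * tau / (C + 1)) <= e / 2 * v * tau.
  rewrite (_ : C * v * _ = e / 2 * v * tau * (C / (C + 1))); last first.
    by field; exact: lt0r_neq0.
  apply: ler_piMr; first by rewrite !mulr_ge0// ltW.
  by rewrite ler_pdivrMr// mul1r lerDl.
have -> : tau^-1 * J - v^-1 * u 0 = (v * J - u 0 * tau) / (v * tau).
  by field; rewrite !lt0r_neq0.
rewrite normrM normfV (gtr0_norm (mulr_gt0 v0 tau0)) ler_pdivrMr ?mulr_gt0//.
rewrite ler_norml; apply/andP; split; lra.
Qed.

End weight.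

(** The positive and negative parts of [f] are again continuous and vanish off [K]; the nonnegative
    case is applied to each with [e / 2]. *)
Lemma equidistribution (f : H -> R) (K : set H) (e : R) : compact K ->
  (forall y, ~ K y -> f y = 0) -> continuous f -> dense (snd @` [set` Lt]) ->
  0 < e -> exists2 r0 : R, 0 < r0 & forall r (a : X), r0 <= r ->
  `|(fine (nu T))^-1 * \int[theta]_y f y
    - (@ball_volume R m r)^-1 * lattice_sum Lt (ball_weight f a r) 0| <= e.
Proof.
move=> cK fK cf denseL e0; have [M fM] := continuous_compact_support_bounded cK cf fK.
have e20 : 0 < e / 2 by rewrite divr_gt0.
pose fp y := (`|f y| + f y) / 2; pose fn y := (`|f y| - f y) / 2.
have cnf : continuous (fun y => `|f y|) by move=> y; apply: cvg_norm; exact: cf.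
have cfp : continuous fp.
  by move=> y; apply: cvgMl; apply: cvgD; [exact: cnf|exact: cf].
have cfn : continuous fn.
  by move=> y; apply: cvgMl; apply: cvgB; [exact: cnf|exact: cf].
have fpK y : ~ K y -> fp y = 0 by move=> /fK fy; rewrite /fp fy normr0 addr0 mul0r.
have fnK y : ~ K y -> fn y = 0 by move=> /fK fy; rewrite /fn fy normr0 subr0 mul0r.
have fpM y : 0 <= fp y <= M.
  have := fM y; have := ler_norm (f y); have := ler_norm (- f y); rewrite normrN /fp.
  by move=> *; apply/andP; split; lra.
have fnM y : 0 <= fn y <= M.
  have := fM y; have := ler_norm (f y); have := ler_norm (- f y); rewrite normrN /fn.
  by move=> *; apply/andP; split; lra.
have fE y : f y = fp y - fn y by rewrite /fp /fn; lra.
have [rp rp0 Pp] := equidistribution_ge0 cK fpK fpM cfp denseL e20.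
have [rn rn0 Pn] := equidistribution_ge0 cK fnK fnM cfn denseL e20.
exists (rp + rn); first by rewrite addr_gt0.
move=> r a rr; have := Pp r a; have := Pn r a.
have -> : rp <= r by rewrite (le_trans _ rr)// lerDl ltW.
have -> : rn <= r by rewrite (le_trans _ rr)// lerDr ltW.
move=> /(_ isT) hn /(_ isT) hp.
have -> : \int[theta]_y f y = \int[theta]_y fp y - \int[theta]_y fn y.
  rewrite -RintegralB//; last 2 first.
  - exact: compact_support_integrable cK fpK cfp.
  - exact: compact_support_integrable cK fnK cfn.
  by apply: eq_Rintegral => y _; exact: fE.
have -> : lattice_sum Lt (ball_weight f a r) 0 =
    lattice_sum Lt (ball_weight fp a r) 0 - lattice_sum Lt (ball_weight fn a r) 0.
  have fL := finite_lattice_points_ball latL 0 a r cK.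
  rewrite !(lattice_sum_fset fL); try by move=> l [].
  - rewrite -sumrB; apply: eq_bigr => l _.
    by rewrite /ball_weight -mulrBr -fE.
  - by move=> l lL /(ball_weight_neq0 fnK)[].
  - by move=> l lL /(ball_weight_neq0 fpK)[].
  - by move=> l lL /(ball_weight_neq0 fK)[].
have split_diff (t u v w x y : R) :
    t * (u - v) - w * (x - y) = (t * u - w * x) - (t * v - w * y) by ring.
by rewrite split_diff [leRHS]splitr (le_trans (ler_normB _ _))// lerD.
Qed.

(** Injectivity of [fst] on the lattice makes it a bijection from the lattice points over the ball
    and [W] onto the points summed on the left, with [star] recovering the second component. *)
Lemma sum_model_set (W : set H) (f : H -> R) (p : X -> R) (a : X) (r : R) :
  compact W -> (forall y, ~ W y -> f y = 0) -> {in Lt &, injective fst} ->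
  (forall x, projected_lattice Lt x -> p x = f (star Lt x)) ->
  \sum_(x \in model_set Lt W `&` euclidean_ball a r) p x =
  lattice_sum Lt (ball_weight f a r) 0.
Proof.
move=> cW fW inj1 pE.
have fL := finite_lattice_points_ball latL 0 a r cW.
rewrite (lattice_sum_fset fL); last 2 first.
- by move=> l [].
- by move=> l lL /(ball_weight_neq0 fW)[].
rewrite -fsbig_finite//.
have injL : {in [set` Lt] &, injective (fst : G -> X)}.
  by move=> l l'; rewrite !inE => lL l'L; exact: inj1.
have starE (l : G) : l \in Lt -> star Lt l.1 = l.2.
  by move=> lL; rewrite /star pinvKV// inE.
rewrite (@reindex_fsbig _ _ _ _ _ fst (lattice_points Lt 0 (euclidean_ball a r) W)).
  apply: eq_fsbigr => l /set_mem[lL Bl _].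
  rewrite pE; last by exists l.
  by rewrite starE// /ball_weight indicE mem_set// mul1r add0r.
split.
- move=> l [lL Bl Wl]; rewrite !add0r in Bl Wl; split=> //.
  by split; [exists l|rewrite starE].
- by move=> l l' /set_mem[lL _ _] /set_mem[l'L _ _]; exact: inj1.
- move=> _ [[[l lL <-] Wl] Bl]; exists l => //; split=> //; rewrite add0r//.
  by rewrite -starE.
Qed.

End equidistribution.

Theorem theorem6p2 (R : realType) (m : nat) (H : topologicalZmodType)
    (Lt : zmodClosed ('rV[R]_m * H)%type)
    (theta : {measure set (borel H) -> \bar R})
    (T : set (borel 'rV[R]_m * borel H))
    (W : set H) (f : H -> R) (p : 'rV[R]_m -> R)
    (hausH : hausdorff_space H)
    (lcH : locally_compact [set: H])
    (cps : cut_and_project_scheme Lt)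
    (haar : haar_measure theta)
    (domT : fundamental_domain Lt T)
    (compW : compact W)
    (intW0 : W° !=set0)
    (clW : W = closure W°)
    (riemW : riemann_measurable theta W)
    (contf : continuous f)
    (suppf : closure [set y | f y != 0] `<=` W)
    (pE : forall x, projected_lattice Lt x -> p x = f (star Lt x)) :
  {uniform, (fun (r : R) (a : 'rV[R]_m) =>
      (fine (lebesgue_rV (euclidean_ball (0 : 'rV[R]_m) r)))^-1 *
      \sum_(x \in model_set Lt W `&` euclidean_ball a r) p x) @ +oo -->
    (fun=> (fine (product_measure theta T))^-1 *
       \int[theta]_(y in [set: borel H]) f y)}.
Proof.
have [latL inj1 denseL] := cps.
have fW y : ~ W y -> f y = 0.
  by move=> nWy; apply: contrapT => /eqP fy; apply/nWy/suppf/subset_closure.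
move=> P /uniform_nbhs[E [entE EP]].
move: entE; rewrite -entourage_ballE => -[e /= e0 eE].
(* The estimate to be used is non-strict while the balls of an entourage are strict, hence
   [e / 2]. *)
have e20 : 0 < e / 2 by rewrite divr_gt0.
have [r0 r00 r0P] :=
  equidistribution haar hausH latL lcH domT compW fW contf denseL e20.
exists r0; split; first exact: num_real.
move=> r r0r; apply: EP => a _; apply: eE.
rewrite /= (sum_model_set latL a r compW fW inj1 pE).
rewrite -ball_normE /ball_/=; apply: (le_lt_trans (r0P r a (ltW r0r))).
by rewrite [ltRHS]splitr ltrDl.
Qed.
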